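(* In a 2-$C^*$-category closed under projections, direct sums and conjugation in which every 1-arrow is a direct sum of centrally balanced 1-arrows, the class of standard solutions of the conjugation equations is stable under the operations of direct sum, tensor product, projections and conjugation. That is: (Direct sum) if $R_i,\bar R_i$ are standard solutions for $\rho_i,\bar\rho_i$ ($i=1,2$, $\rho_1,\rho_2$ parallel), and $W_i\in\mathrm{Hom}(\rho_i,\rho)$, $\bar W_i\in\mathrm{Hom}(\bar\rho_i,\bar\rho)$ are isometries realizing $\rho=\rho_1\oplus\rho_2$, $\bar\rho=\bar\rho_1\oplus\bar\rho_2$, then $\sum_i(\bar W_i\otimes W_i)\circ R_i,\ \sum_i(W_i\otimes\bar W_i)\circ\bar R_i$ is a standard solution for $\rho,\bar\rho$. (Tensor product) if $R_\rho,\bar R_\rho$ and $R_\sigma,\bar R_\sigma$ are standard solutions for $B\xleftarrow{\rho}A$ and $C\xleftarrow{\sigma}B$, then $(1_{\bar\rho}\otimes R_\sigma\otimes1_\rho)\circ R_\rho,\ (1_\sigma\otimes\bar R_\rho\otimes1_{\bar\sigma})\circ\bar R_\sigma$ is a standard solution for $\sigma\otimes\rho,\ \bar\rho\otimes\bar\sigma$. (Projections) if $R,\bar R$ is a standard solution for $\rho,\bar\rho$ and $W\in\mathrm{Hom}(\rho_P,\rho)$ is an isometry with $W\circ W^*=P$ a projection in $\mathrm{End}(\rho)$, then there are a sub-1-arrow $\bar\rho_P$ of $\bar\rho$ and an isometry $\bar W\in\mathrm{Hom}(\bar\rho_P,\bar\rho)$ such that $(\bar W^*\otimes W^* )\circ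 R,\ (W^*\otimes\bar W^* )\circ\bar R$ is a standard solution for $\rho_P,\bar\rho_P$. (Conjugation) if $R,\bar R$ is a standard solution for $\rho,\bar\rho$, then $\bar R,R$ is a standard solution for $\bar\rho,\rho$.
   Context: A 2-$C^*$-category is a strict 2-category (1-arrows $B\xleftarrow{\rho}A$ composed by $\otimes$, with unit 1-arrows $\iota_A$; 2-arrows $S\in\mathrm{Hom}(\rho,\sigma)$ between parallel 1-arrows, with vertical composition $\circ$, units $1_\rho$, and horizontal composition $\otimes$; $\mathrm{End}(\rho)=\mathrm{Hom}(\rho,\rho)$) such that every $\mathrm{Hom}(\rho,\sigma)$ is a complex Banach space, compositions are bilinear, there is an antilinear involution $*:\mathrm{Hom}(\rho,\sigma)\to\mathrm{Hom}(\sigma,\rho)$ with $(S\circ T)^*=T^*\circ S^*$ and $(S\otimes T)^*=S^*\otimes T^*$, $\|T\circ S\|\le\|T\|\|S\|$, $\|S^*\circ S\|=\|S\|^2$, and $S^*\circ S$ is positive. Closed under projections: for each projection $P\in\mathrm{End}(\rho)$ there are a (sub-)1-arrow $\rho_P$ and $W\in\mathrm{Hom}(\rho_P,\rho)$ with $W^*\circ W=1_{\rho_P}$, $W\circ W^*=P$. Direct sums $\rho=\oplus_i\rho_i$ (finite): given by $W_i\in\mathrm{Hom}(\rho_i,\rho)$ with $W_i^*\circ W_j=\delta_{ij}1_{\rho_i}$, $\sum_iW_i\circ W_i^*=1_\rho$. Closed under conjugation: for each $B\xleftarrow{\rho}A$ there are $A\xleftarrow{\bar\rho}B$ and a solution of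 the conjugation equations $R\in\mathrm{Hom}(\iota_A,\bar\rho\otimes\rho)$, $\bar R\in\mathrm{Hom}(\iota_B,\rho\otimes\bar\rho)$: $(\bar R^*\otimes1_\rho)\circ(1_\rho\otimes R)=1_\rho$, $(R^*\otimes1_{\bar\rho})\circ(1_{\bar\rho}\otimes\bar R)=1_{\bar\rho}$. $B\xleftarrow{\rho}A$ is centrally balanced if $\mathrm{End}(\iota_B)\otimes1_\rho=1_\rho\otimes\mathrm{End}(\iota_A)$. For $\rho,\bar\rho$ centrally balanced, a solution $R,\bar R$ is standard if $1_\rho\otimes(R^*\circ(1_{\bar\rho}\otimes X)\circ R)=(\bar R^*\circ(X\otimes1_{\bar\rho})\circ\bar R)\otimes1_\rho$ for all $X\in\mathrm{End}(\rho)$. For general $\rho,\bar\rho$, a solution $R,\bar R$ is standard if there are direct sum decompositions $\rho=\oplus_i\rho_i$, $\bar\rho=\oplus_i\bar\rho_i$ into centrally balanced 1-arrows, given by isometries $W_i\in\mathrm{Hom}(\rho_i,\rho)$, $\bar W_i\in\mathrm{Hom}(\bar\rho_i,\bar\rho)$, and standard solutions $R_i,\bar R_i$ for $\rho_i,\bar\rho_i$ such that $R=\sum_i(\bar W_i\otimes W_i)\circ R_i$, $\bar R=\sum_i(W_i\otimes\bar W_i)\circ\bar R_i$. *)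

(* Defs.v *)
From mathcomp Require Import all_boot all_order all_algebra.
From mathcomp Require Import all_classical all_reals all_analysis.
From mathcomp Require Import complex.
Set Implicit Arguments.
Unset Strict Implicit.
Unset Printing Implicit Defensive.
Import Order.TTheory GRing.Theory Num.Theory.
Import numFieldNormedType.Exports.

Local Open Scope classical_set_scope.
Local Open Scope ring_scope.

(* [arr B A] is the type of 1-arrows B <- A, so that [tens s r] (written
   [s \ox r]) with s : C <- B and r : B <- A is a 1-arrow C <- A.  Strictness
   of the 2-category means that associativity and unitality of [tens] are
   equalities of 1-arrows. *)
Record arrowCat := ArrowCat {
  obj :> Type;
  arr : obj -> obj -> Type;
  unit1 : forall A, arr A A;
  tens : forall {X B A}, arr X B -> arr B A -> arr X A;
  tensA : forall {D X B A} (t : arr D X) (s : arr X B) (r : arr B A),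
    tens (tens t s) r = tens t (tens s r);
  tens1l : forall {B A} (r : arr B A), tens (unit1 B) r = r;
  tens1r : forall {B A} (r : arr B A), tens r (unit1 A) = r }.

Declare Scope twocat_scope.
Delimit Scope twocat_scope with TC.
#[global] Open Scope twocat_scope.

Reserved Notation "s \ox r" (at level 40, left associativity).
Reserved Notation "S \vo T" (at level 48, left associativity).
Reserved Notation "S \hx T" (at level 40, left associativity).
Notation "s \ox r" := (tens s r) : twocat_scope.

(* The spaces of 2-arrows are complex Banach spaces; note that the norm of a
   [normedModType R[i]] takes its (real, nonnegative) values in R[i]. *)
Record twoArrows (R : realType) (C : arrowCat) := TwoArrows {
  hom : forall {B A : C}, arr B A -> arr B A -> completeNormedModType R[i];
  id2 : forall {B A : C} (r : arr B A), hom r r;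
  vcomp : forall {B A : C} {r s t : arr B A}, hom s t -> hom r s -> hom r t;
  hcomp : forall {X B A : C} {s s' : arr X B} {r r' : arr B A},
    hom s s' -> hom r r' -> hom (s \ox r) (s' \ox r');
  dag : forall {B A : C} {r s : arr B A}, hom r s -> hom s r }.

Arguments hom {R C} H {B A} _ _ : rename.
Arguments id2 {R C H B A} r : rename.
Arguments vcomp {R C H B A r s t} _ _ : rename.
Arguments hcomp {R C H X B A s s' r r'} _ _ : rename.
Arguments dag {R C H B A r s} _ : rename.

Notation "S \vo T" := (vcomp S T) : twocat_scope.
Notation "S \hx T" := (hcomp S T) : twocat_scope.

Section TwoArrowsTheory.
Variables (R : realType) (C : arrowCat) (H : twoArrows R C).

(* The identity 2-arrow of r, seen as a 2-arrow from r to s when r and s are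
   equal 1-arrows; it is what mediates between, e.g., (t \ox s) \ox r and
   t \ox (s \ox r), which are equal but not convertible. *)
Definition idto {B A : C} {r s : arr B A} (e : r = s) : hom H r s :=
  match e in _ = x return hom H r x with erefl => id2 r end.

Definition invertible {B A : C} {r : arr B A} (S : hom H r r) : Prop :=
  exists T : hom H r r, T \vo S = id2 r /\ S \vo T = id2 r.

(* 0 <= a in R[i] means that a is a nonnegative real. *)
Definition is_positive {B A : C} {r : arr B A} (S : hom H r r) : Prop :=
  dag S = S /\
  forall a : R[i], ~ invertible (S - a *: id2 r) -> 0 <= a.

Definition is_isometry {B A : C} {r s : arr B A} (W : hom H r s) : Prop :=
  dag W \vo W = id2 r.

Definition is_projection {B A : C} {r : arr B A} (P : hom H r r) : Prop :=
  P \vo P = P /\ dag P = P.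

End TwoArrowsTheory.

Arguments idto {R C H B A r s} e.

Record is_twoCstar (R : realType) (C : arrowCat) (H : twoArrows R C) : Prop :=
  IsTwoCstar {
  vcompA : forall (B A : C) (q r s t : arr B A)
      (U : hom H s t) (T : hom H r s) (S : hom H q r),
    U \vo (T \vo S) = (U \vo T) \vo S;
  vcomp1l : forall (B A : C) (r s : arr B A) (S : hom H r s),
    id2 s \vo S = S;
  vcomp1r : forall (B A : C) (r s : arr B A) (S : hom H r s),
    S \vo id2 r = S;
  hcomp_id2 : forall (X B A : C) (s : arr X B) (r : arr B A),
    id2 s \hx id2 r = id2 (s \ox r) :> hom H _ _;
  interchange : forall (X B A : C) (s s' s'' : arr X B) (r r' r'' : arr B A)
      (S' : hom H s' s'') (S : hom H s s')
      (T' : hom H r' r'') (T : hom H r r'),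
    (S' \vo S) \hx (T' \vo T) = (S' \hx T') \vo (S \hx T);
  (* strict associativity and unitality of the horizontal composition *)
  hcompA : forall (D X B A : C) (t t' : arr D X) (s s' : arr X B)
      (r r' : arr B A) (U : hom H t t') (S : hom H s s') (T : hom H r r'),
    idto (tensA t' s' r') \vo ((U \hx S) \hx T) =
    (U \hx (S \hx T)) \vo idto (tensA t s r);
  hcomp1l : forall (B A : C) (r r' : arr B A) (S : hom H r r'),
    idto (tens1l r') \vo (id2 (unit1 B) \hx S) = S \vo idto (tens1l r);
  hcomp1r : forall (B A : C) (r r' : arr B A) (S : hom H r r'),
    idto (tens1r r') \vo (S \hx id2 (unit1 A)) = S \vo idto (tens1r r);
  vcomp_linl : forall (B A : C) (r s t : arr B A) (a : R[i])
      (T T' : hom H s t) (S : hom H r s),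
    (a *: T + T') \vo S = a *: (T \vo S) + T' \vo S;
  vcomp_linr : forall (B A : C) (r s t : arr B A) (a : R[i])
      (T : hom H s t) (S S' : hom H r s),
    T \vo (a *: S + S') = a *: (T \vo S) + T \vo S';
  hcomp_linl : forall (X B A : C) (s s' : arr X B) (r r' : arr B A)
      (a : R[i]) (S S' : hom H s s') (T : hom H r r'),
    (a *: S + S') \hx T = a *: (S \hx T) + S' \hx T;
  hcomp_linr : forall (X B A : C) (s s' : arr X B) (r r' : arr B A)
      (a : R[i]) (S : hom H s s') (T T' : hom H r r'),
    S \hx (a *: T + T') = a *: (S \hx T) + S \hx T';
  dag_antilinear : forall (B A : C) (r s : arr B A) (a : R[i])
      (S T : hom H r s),
    dag (a *: S + T) = Num.conj a *: dag S + dag T;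
  dagK : forall (B A : C) (r s : arr B A) (S : hom H r s), dag (dag S) = S;
  dag_vcomp : forall (B A : C) (r s t : arr B A)
      (S : hom H s t) (T : hom H r s),
    dag (S \vo T) = dag T \vo dag S;
  dag_hcomp : forall (X B A : C) (s s' : arr X B) (r r' : arr B A)
      (S : hom H s s') (T : hom H r r'),
    dag (S \hx T) = dag S \hx dag T;
  norm_vcomp : forall (B A : C) (r s t : arr B A)
      (T : hom H s t) (S : hom H r s),
    `|T \vo S| <= `|T| * `|S|;
  norm_Cstar : forall (B A : C) (r s : arr B A) (S : hom H r s),
    `|dag S \vo S| = `|S| ^+ 2;
  dag_vcomp_positive : forall (B A : C) (r s : arr B A) (S : hom H r s),
    is_positive (dag S \vo S) }.

Record twoCstarCat (R : realType) := TwoCstarCat {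
  arrowcat :> arrowCat;
  twoarrows : twoArrows R arrowcat;
  twoCstarP : is_twoCstar twoarrows }.

Definition arr2 {R : realType} {C : twoCstarCat R} {B A : C} (r s : arr B A) :
  completeNormedModType R[i] := hom (twoarrows C) r s.

Section Notions.
Variables (R : realType) (C : twoCstarCat R).

Definition closed_under_projections : Prop :=
  forall (B A : C) (r : arr B A) (P : arr2 r r), is_projection P ->
  exists (rP : arr B A) (W : arr2 rP r), is_isometry W /\ W \vo dag W = P.

(* For i <> j the 2-arrow dag (W i) \vo W j lies in arr2 (r_ j) (r_ i); the
   case i = j of W_i^* o W_j = delta_ij 1 is therefore stated apart. *)
Definition is_dsum {B A : C} {n : nat} (r_ : 'I_n -> arr B A) (r : arr B A)
    (W : forall i, arr2 (r_ i) r) : Prop :=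
  [/\ forall i, is_isometry (W i),
      forall i j, i != j -> dag (W i) \vo W j = 0
    & \sum_(i < n) (W i \vo dag (W i)) = id2 r].

Definition closed_under_dsums : Prop :=
  forall (B A : C) (n : nat) (r_ : 'I_n.+1 -> arr B A),
  exists (r : arr B A) (W : forall i, arr2 (r_ i) r), is_dsum W.

(* (Rb^* (x) 1_r) o (1_r (x) R) = 1_r : r = r (unit1 A) -> r (rb r) = (r rb) r
   -> (unit1 B) r = r *)
Definition conj_eq {B A : C} {r : arr B A} {rb : arr A B}
    (Rr : arr2 (unit1 A) (rb \ox r)) (Rb : arr2 (unit1 B) (r \ox rb)) : Prop :=
  idto (tens1l r) \vo (dag Rb \hx id2 r) \vo idto (esym (tensA r rb r))
    \vo (id2 r \hx Rr) \vo idto (esym (tens1r r)) = id2 r.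

Definition is_solution {B A : C} {r : arr B A} {rb : arr A B}
    (Rr : arr2 (unit1 A) (rb \ox r)) (Rb : arr2 (unit1 B) (r \ox rb)) : Prop :=
  conj_eq Rr Rb /\ conj_eq Rb Rr.

Definition closed_under_conjugation : Prop :=
  forall (B A : C) (r : arr B A),
  exists (rb : arr A B) (Rr : arr2 (unit1 A) (rb \ox r))
    (Rb : arr2 (unit1 B) (r \ox rb)), is_solution Rr Rb.

(* z (x) 1_r and 1_r (x) z as elements of End(r), for z in the endomorphisms
   of a unit 1-arrow. *)
Definition lact {B A : C} (r : arr B A) (z : arr2 (unit1 B) (unit1 B)) :
    arr2 r r :=
  idto (tens1l r) \vo (z \hx id2 r) \vo idto (esym (tens1l r)).

Definition ract {B A : C} (r : arr B A) (z : arr2 (unit1 A) (unit1 A)) :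
    arr2 r r :=
  idto (tens1r r) \vo (id2 r \hx z) \vo idto (esym (tens1r r)).

Definition centrally_balanced {B A : C} (r : arr B A) : Prop :=
  range (lact r) = range (ract r).

(* Only meant for centrally balanced r and rb. *)
Definition is_standard_balanced {B A : C} {r : arr B A} {rb : arr A B}
    (Rr : arr2 (unit1 A) (rb \ox r)) (Rb : arr2 (unit1 B) (r \ox rb)) : Prop :=
  is_solution Rr Rb /\
  forall X : arr2 r r,
    ract r (dag Rr \vo (id2 rb \hx X) \vo Rr) =
    lact r (dag Rb \vo (X \hx id2 rb) \vo Rb).

(* \sum_i (Wb_i (x) W_i) o R_i *)
Definition dsum_sol {B A : C} {n : nat}
    {r_ : 'I_n -> arr B A} {rb_ : 'I_n -> arr A B}
    {r : arr B A} {rb : arr A B}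
    (W : forall i, arr2 (r_ i) r) (Wb : forall i, arr2 (rb_ i) rb)
    (R_ : forall i, arr2 (unit1 A) (rb_ i \ox r_ i)) :
    arr2 (unit1 A) (rb \ox r) :=
  \sum_(i < n) ((Wb i \hx W i) \vo R_ i).

Definition is_standard {B A : C} {r : arr B A} {rb : arr A B}
    (Rr : arr2 (unit1 A) (rb \ox r)) (Rb : arr2 (unit1 B) (r \ox rb)) : Prop :=
  is_solution Rr Rb /\
  exists (n : nat) (r_ : 'I_n -> arr B A) (rb_ : 'I_n -> arr A B)
    (W : forall i, arr2 (r_ i) r) (Wb : forall i, arr2 (rb_ i) rb)
    (R_ : forall i, arr2 (unit1 A) (rb_ i \ox r_ i))
    (Rb_ : forall i, arr2 (unit1 B) (r_ i \ox rb_ i)),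
    [/\ is_dsum W /\ is_dsum Wb,
        forall i, centrally_balanced (r_ i) /\ centrally_balanced (rb_ i),
        forall i, is_standard_balanced (R_ i) (Rb_ i)
      & Rr = dsum_sol W Wb R_ /\ Rb = dsum_sol Wb W Rb_].

Definition all_dsum_of_centrally_balanced : Prop :=
  forall (B A : C) (r : arr B A),
  exists (n : nat) (r_ : 'I_n -> arr B A) (W : forall i, arr2 (r_ i) r),
    is_dsum W /\ forall i, centrally_balanced (r_ i).

Lemma tens_middle {X B A : C} (m : arr A B) (a : arr B X) (b : arr X B)
    (v : arr B A) : m \ox ((a \ox b) \ox v) = (m \ox a) \ox (b \ox v).
Proof. by rewrite (tensA a b v) tensA. Qed.

(* (1_m (x) S (x) 1_v) o T : (unit1 A) -> m v = m (unit1 B) v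
   -> m ((a b) v) = (m a) (b v) *)
Definition tens_sol {X B A : C} {m : arr A B} {a : arr B X} {b : arr X B}
    {v : arr B A} (S : arr2 (unit1 B) (a \ox b)) (T : arr2 (unit1 A) (m \ox v)) :
    arr2 (unit1 A) ((m \ox a) \ox (b \ox v)) :=
  idto (tens_middle m a b v) \vo (id2 m \hx (S \hx id2 v))
    \vo (id2 m \hx idto (esym (tens1l v))) \vo T.

End Notions.

Arguments closed_under_projections {R} C.
Arguments closed_under_dsums {R} C.
Arguments closed_under_conjugation {R} C.
Arguments all_dsum_of_centrally_balanced {R} C.

(* Main.v *)
(** A solution of the conjugation equations is an adjunction, which transposes
    2-arrows r -> s into 2-arrows sb -> rb.  Between centrally balanced 1-arrows
    with standard solutions, the equality of the left and right inverses up to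
    the action of the scalars forces the modular map of transposition to square
    to the identity; being positive, this map is then trivial, so transposition
    preserves the involution.  This passes to arbitrary standard solutions
    through their decompositions.  Hence the transpose of a projection is a
    projection, which provides the conjugate of a sub-1-arrow; decomposing the
    sub-1-arrow into centrally balanced pieces p, the standardness of the
    compressed solutions is the identity
      1_p (x) phi(T o S) = psi(T o S) (x) 1_p    (T : p -> r, S : r -> p),
    which holds because the difference of the two sides is central and
    nilpotent.  The other three stability properties reduce to centrally
    balanced 1-arrows by distributing over the decompositions. *)
Require Import Defs.
From mathcomp Require Import all_boot all_algebra all_reals all_analysis complex.
From mathcomp Require Import boolp classical_sets.
Set Implicit Arguments.
Unset Strict Implicit.
Unset Printing Implicit Defensive.
Import GRing.Theory Num.Theory.

Local Open Scope classical_set_scope.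
Local Open Scope ring_scope.

(** * Linear calculus of 2-arrows and first consequences of the C*-identity *)

Section Algebra.
Variables (R : realType) (C : twoCstarCat R).

(* v and h stand for vertical and horizontal composition, l and r for the
   argument in which a lemma is linear or unital. *)
Lemma vA {B A : C} {q r s t : arr B A}
    (U : arr2 s t) (T : arr2 r s) (S : arr2 q r) :
  U \vo (T \vo S) = U \vo T \vo S.
Proof. exact: vcompA (twoCstarP C) _ _ _ _ _ _ U T S. Qed.

Lemma v1l {B A : C} {r s : arr B A} (S : arr2 r s) : id2 s \vo S = S.
Proof. exact: vcomp1l (twoCstarP C) _ _ _ _ S. Qed.

Lemma v1r {B A : C} {r s : arr B A} (S : arr2 r s) : S \vo id2 r = S.
Proof. exact: vcomp1r (twoCstarP C) _ _ _ _ S. Qed.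

Lemma h11 {X B A : C} (s : arr X B) (r : arr B A) :
  id2 s \hx id2 r = id2 (s \ox r) :> arr2 _ _.
Proof. exact: hcomp_id2 (twoCstarP C) _ _ _ s r. Qed.

Lemma hv {X B A : C} {s s' s'' : arr X B} {r r' r'' : arr B A}
    (S' : arr2 s' s'') (S : arr2 s s') (T' : arr2 r' r'') (T : arr2 r r') :
  (S' \hx T') \vo (S \hx T) = (S' \vo S) \hx (T' \vo T).
Proof. by rewrite (Defs.interchange (twoCstarP C)). Qed.

Lemma dagv {B A : C} {r s t : arr B A} (S : arr2 s t) (T : arr2 r s) :
  dag (S \vo T) = dag T \vo dag S.
Proof. exact: dag_vcomp (twoCstarP C) _ _ _ _ _ S T. Qed.

Lemma dagh {X B A : C} {s s' : arr X B} {r r' : arr B A}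
    (S : arr2 s s') (T : arr2 r r') : dag (S \hx T) = dag S \hx dag T.
Proof. exact: dag_hcomp (twoCstarP C) _ _ _ _ _ _ _ S T. Qed.

Lemma dagKK {B A : C} {r s : arr B A} (S : arr2 r s) : dag (dag S) = S.
Proof. exact: dagK (twoCstarP C) _ _ _ _ S. Qed.

Lemma dag_inj {B A : C} {r s : arr B A} : injective (fun S : arr2 r s => dag S).
Proof. exact: can_inj dagKK. Qed.

Lemma dag1 {B A : C} (r : arr B A) : dag (id2 r) = id2 r :> arr2 r r.
Proof. by rewrite -[LHS]v1r -{2}[id2 r]dagKK -dagv v1r dagKK. Qed.

Lemma vlinl {B A : C} {r s t : arr B A} (S : arr2 r s) a (T T' : arr2 s t) :
  (a *: T + T') \vo S = a *: (T \vo S) + T' \vo S.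
Proof. exact: vcomp_linl (twoCstarP C) _ _ _ _ _ a T T' S. Qed.

Lemma vlinr {B A : C} {r s t : arr B A} (T : arr2 s t) a (S S' : arr2 r s) :
  T \vo (a *: S + S') = a *: (T \vo S) + T \vo S'.
Proof. exact: vcomp_linr (twoCstarP C) _ _ _ _ _ a T S S'. Qed.

Lemma hlinl {X B A : C} {s s' : arr X B} {r r' : arr B A}
    (T : arr2 r r') a (S S' : arr2 s s') :
  (a *: S + S') \hx T = a *: (S \hx T) + S' \hx T.
Proof. exact: hcomp_linl (twoCstarP C) _ _ _ _ _ _ _ a S S' T. Qed.

Lemma hlinr {X B A : C} {s s' : arr X B} {r r' : arr B A}
    (S : arr2 s s') a (T T' : arr2 r r') :
  S \hx (a *: T + T') = a *: (S \hx T) + S \hx T'.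
Proof. exact: hcomp_linr (twoCstarP C) _ _ _ _ _ _ _ a S T T'. Qed.

Lemma lin_add (U V : lmodType R[i]) (f : U -> V) :
  (forall a x y, f (a *: x + y) = a *: f x + f y) ->
  [/\ f 0 = 0, {morph f : x / - x}, {morph f : x y / x + y}
    & forall (I : Type) (s : seq I) (P : pred I) (F : I -> U),
        f (\sum_(i <- s | P i) F i) = \sum_(i <- s | P i) f (F i)].
Proof.
move=> fl.
have fD : {morph f : x y / x + y} by move=> x y; rewrite -[x]scale1r fl !scale1r.
have f0 : f 0 = 0 by apply: (addrI (f 0)); rewrite -fD !addr0.
split=> //; last by move=> I s P F; exact: (big_morph f fD f0).
by move=> x; apply/eqP; rewrite -addr_eq0 -fD addNr f0.
Qed.

Section VComp.
Context {B A : C} {r s t : arr B A}.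

Lemma v0l (S : arr2 r s) : (0 : arr2 s t) \vo S = 0.
Proof. by have [] := lin_add (vlinl (t := t) S). Qed.
Lemma vNl (S : arr2 r s) (T : arr2 s t) : (- T) \vo S = - (T \vo S).
Proof. by have [] := lin_add (vlinl (t := t) S). Qed.
Lemma vDl (S : arr2 r s) (T T' : arr2 s t) : (T + T') \vo S = T \vo S + T' \vo S.
Proof. by have [] := lin_add (vlinl (t := t) S). Qed.
Lemma vBl (S : arr2 r s) (T T' : arr2 s t) : (T - T') \vo S = T \vo S - T' \vo S.
Proof. by rewrite vDl vNl. Qed.
Lemma v_suml (S : arr2 r s) I (u : seq I) P (F : I -> arr2 s t) :
  (\sum_(i <- u | P i) F i) \vo S = \sum_(i <- u | P i) (F i \vo S).
Proof. by have [_ _ _ ->] := lin_add (vlinl (t := t) S). Qed.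
Lemma v0r (T : arr2 s t) : T \vo (0 : arr2 r s) = 0.
Proof. by have [] := lin_add (vlinr (r := r) T). Qed.
Lemma vNr (T : arr2 s t) (S : arr2 r s) : T \vo (- S) = - (T \vo S).
Proof. by have [] := lin_add (vlinr (r := r) T). Qed.
Lemma vDr (T : arr2 s t) (S S' : arr2 r s) : T \vo (S + S') = T \vo S + T \vo S'.
Proof. by have [] := lin_add (vlinr (r := r) T). Qed.
Lemma vBr (T : arr2 s t) (S S' : arr2 r s) : T \vo (S - S') = T \vo S - T \vo S'.
Proof. by rewrite vDr vNr. Qed.
Lemma v_sumr (T : arr2 s t) I (u : seq I) P (F : I -> arr2 r s) :
  T \vo (\sum_(i <- u | P i) F i) = \sum_(i <- u | P i) (T \vo F i).
Proof. by have [_ _ _ ->] := lin_add (vlinr (r := r) T). Qed.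
End VComp.

Section HComp.
Context {X B A : C} {s s' : arr X B} {r r' : arr B A}.

Lemma h0l (T : arr2 r r') : (0 : arr2 s s') \hx T = 0.
Proof. by have [] := lin_add (hlinl (s := s) (s' := s') T). Qed.
Lemma hNl (T : arr2 r r') (S : arr2 s s') : (- S) \hx T = - (S \hx T).
Proof. by have [] := lin_add (hlinl (s := s) (s' := s') T). Qed.
Lemma hDl (T : arr2 r r') (S S' : arr2 s s') : (S + S') \hx T = S \hx T + S' \hx T.
Proof. by have [] := lin_add (hlinl (s := s) (s' := s') T). Qed.
Lemma hBl (T : arr2 r r') (S S' : arr2 s s') : (S - S') \hx T = S \hx T - S' \hx T.
Proof. by rewrite hDl hNl. Qed.
Lemma h_suml (T : arr2 r r') I (u : seq I) P (F : I -> arr2 s s') :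
  (\sum_(i <- u | P i) F i) \hx T = \sum_(i <- u | P i) (F i \hx T).
Proof. by have [_ _ _ ->] := lin_add (hlinl (s := s) (s' := s') T). Qed.
Lemma h0r (S : arr2 s s') : S \hx (0 : arr2 r r') = 0.
Proof. by have [] := lin_add (hlinr (r := r) (r' := r') S). Qed.
Lemma hNr (S : arr2 s s') (T : arr2 r r') : S \hx (- T) = - (S \hx T).
Proof. by have [] := lin_add (hlinr (r := r) (r' := r') S). Qed.
Lemma hDr (S : arr2 s s') (T T' : arr2 r r') : S \hx (T + T') = S \hx T + S \hx T'.
Proof. by have [] := lin_add (hlinr (r := r) (r' := r') S). Qed.
Lemma hBr (S : arr2 s s') (T T' : arr2 r r') : S \hx (T - T') = S \hx T - S \hx T'.
Proof. by rewrite hDr hNr. Qed.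
Lemma h_sumr (S : arr2 s s') I (u : seq I) P (F : I -> arr2 r r') :
  S \hx (\sum_(i <- u | P i) F i) = \sum_(i <- u | P i) (S \hx F i).
Proof. by have [_ _ _ ->] := lin_add (hlinr (r := r) (r' := r') S). Qed.
End HComp.

Section Dag.
Context {B A : C} {r s : arr B A}.

Lemma dagD (S T : arr2 r s) : dag (S + T) = dag S + dag T.
Proof.
have := dag_antilinear (twoCstarP C) 1 S T.
by rewrite !scale1r rmorph1 scale1r.
Qed.
Lemma dag0 : dag (0 : arr2 r s) = 0.
Proof. by apply: (addrI (dag (0 : arr2 r s))); rewrite -dagD !addr0. Qed.
Lemma dag_sum I (u : seq I) P (F : I -> arr2 r s) :
  dag (\sum_(i <- u | P i) F i) = \sum_(i <- u | P i) dag (F i).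
Proof. exact: (big_morph (fun S : arr2 r s => dag S) dagD dag0). Qed.

Lemma dagv_eq0 (S : arr2 r s) : dag S \vo S = 0 -> S = 0.
Proof.
move=> SS0; have := norm_Cstar (twoCstarP C) S.
by rewrite SS0 normr0 => /esym/eqP; rewrite sqrf_eq0 normr_eq0 => /eqP.
Qed.

End Dag.

Lemma selfadj_sq_eq0 {B A : C} {r : arr B A} (S : arr2 r r) :
  dag S = S -> S \vo S = 0 -> S = 0.
Proof. by move=> Sa SS0; apply: dagv_eq0; rewrite Sa. Qed.

(* A pair of 2-arrows out of the same 1-arrow is a single 2-arrow (a column)
   into the direct sum of the targets, to which the C*-identity applies. *)
Lemma dagv_add_eq0 (hdsum : closed_under_dsums C) {B A : C} {a b c : arr B A}
    (U : arr2 a b) (V : arr2 a c) :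
  dag U \vo U + dag V \vo V = 0 -> U = 0.
Proof.
move=> UV0.
have [t [W [Wi Wo _]]] := hdsum _ _ 1 (fun i : 'I_2 => if i == ord0 then b else c).
have {}Wi i := Wi i.
have W0 := Wi ord0; have W1 := Wi ord_max.
have W01 := Wo ord0 ord_max isT; have W10 := Wo ord_max ord0 isT.
(* Once abstracted, the two isometries have the types [arr2 b t] and [arr2 c t], because the
   conditional in the family reduces. *)
move: (W ord0) (W ord_max) W0 W1 W01 W10 => /= W0 W1 W00 W11 W01 W10.
rewrite /is_isometry in W00 W11.
have UE : U = dag W0 \vo (W0 \vo U + W1 \vo V).
  by rewrite vDr !vA W00 W01 v1l v0l addr0.
suff -> : U = dag W0 \vo (0 : arr2 a t) by rewrite v0r.
rewrite [LHS]UE; congr (_ \vo _); apply: dagv_eq0.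
rewrite dagD !dagv !vDr !vDl !vA -!(vA _ (dag W0)) -!(vA _ (dag W1)).
by rewrite W00 W11 W01 W10 !v0r !v0l !v1r addr0 add0r.
Qed.

End Algebra.

(** * Equality up to the strictness isomorphisms *)

Section Heq.
Variables (R : realType) (C : twoCstarCat R).

(** Strictness makes two bracketings of a 1-arrow equal but not convertible, so [=] cannot compare
    2-arrows between them. Hiding the mediating equalities under an existential leaves a relation
    that composes freely. *)
Definition heq {B A : C} {r s r' s' : arr B A} (X : arr2 r s) (Y : arr2 r' s') :=
  exists (e : r' = r) (f : s = s'), Y = idto f \vo X \vo idto e.

(** By proof irrelevance the mediating equalities are [erefl]. Computations with [heq] return to
    plain equations here. *)
Lemma heq_eq {B A : C} {r s : arr B A} (X Y : arr2 r s) : heq X Y -> X = Y.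
Proof.
case=> e [f ->]; rewrite (Prop_irrelevance e erefl) (Prop_irrelevance f erefl).
by rewrite /= v1l v1r.
Qed.

Lemma heq_refl {B A : C} {r s : arr B A} (X : arr2 r s) : heq X X.
Proof. by exists erefl, erefl; rewrite /= v1l v1r. Qed.

Lemma eq_heq {B A : C} {r s : arr B A} (X Y : arr2 r s) : X = Y -> heq X Y.
Proof. by move->; exact: heq_refl. Qed.

Section Binary.
Context {B A : C} {r s r' s' : arr B A}.

Lemma heq_sym (X : arr2 r s) (Y : arr2 r' s') : heq X Y -> heq Y X.
Proof. by case=> e [f ->]; subst; rewrite /= v1l v1r; exact: heq_refl. Qed.

Lemma heq_trans {r'' s'' : arr B A} (X : arr2 r s) (Y : arr2 r' s')
    (Z : arr2 r'' s'') : heq X Y -> heq Y Z -> heq X Z.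
Proof. by case=> e [f ->]; subst; rewrite /= v1l v1r. Qed.

Lemma heq_dag (X : arr2 r s) (Y : arr2 r' s') : heq X Y -> heq (dag X) (dag Y).
Proof. by case=> e [f ->]; subst; rewrite /= v1l v1r; exact: heq_refl. Qed.

Lemma heq_vcomp {t t' : arr B A} (Y : arr2 s t) (X : arr2 r s)
    (Y' : arr2 s' t') (X' : arr2 r' s') :
  heq Y Y' -> heq X X' -> heq (Y \vo X) (Y' \vo X').
Proof.
case=> e [f ->] [e' [f' ->]]; subst.
rewrite (Prop_irrelevance f' erefl) /= !v1l !v1r; exact: heq_refl.
Qed.

Lemma heq_id2 : r = r' -> heq (id2 r : arr2 r r) (id2 r' : arr2 r' r').
Proof. by move=> e; subst; exact: heq_refl. Qed.

Lemma heq_idtol {t : arr B A} (e : s = t) (X : arr2 r s) (Y : arr2 r' s') :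
  heq X Y -> heq (idto e \vo X) Y.
Proof. by subst; rewrite /= v1l. Qed.

Lemma heq_idtor {t : arr B A} (e : t = r) (X : arr2 r s) (Y : arr2 r' s') :
  heq X Y -> heq (X \vo idto e) Y.
Proof. by subst; rewrite /= v1r. Qed.
End Binary.

Lemma heq_hcomp {X B A : C} {s t s' t' : arr X B} {r q r' q' : arr B A}
    (S : arr2 s t) (T : arr2 r q) (S' : arr2 s' t') (T' : arr2 r' q') :
  heq S S' -> heq T T' -> heq (S \hx T) (S' \hx T').
Proof.
case=> e [f ->] [e' [f' ->]]; subst.
rewrite /= !v1l !v1r; exact: heq_refl.
Qed.

Lemma heq_hcompA {D X B A : C} {t t' : arr D X} {s s' : arr X B}
    {r r' : arr B A} (U : arr2 t t') (S : arr2 s s') (T : arr2 r r') :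
  heq ((U \hx S) \hx T) (U \hx (S \hx T)).
Proof.
apply: heq_trans (heq_sym (heq_idtol (tensA t' s' r') (heq_refl _))) _.
rewrite (hcompA (twoCstarP C)); apply: heq_idtor; exact: heq_refl.
Qed.

Lemma heq_hcomp1l {B A : C} {r s : arr B A} (S : arr2 r s) :
  heq ((id2 (unit1 B) : arr2 _ _) \hx S) S.
Proof.
apply: heq_trans (heq_sym (heq_idtol (tens1l s) (heq_refl _))) _.
rewrite (hcomp1l (twoCstarP C)); apply: heq_idtor; exact: heq_refl.
Qed.

Lemma heq_hcomp1r {B A : C} {r s : arr B A} (S : arr2 r s) :
  heq (S \hx (id2 (unit1 A) : arr2 _ _)) S.
Proof.
apply: heq_trans (heq_sym (heq_idtol (tens1r s) (heq_refl _))) _.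
rewrite (hcomp1r (twoCstarP C)); apply: heq_idtor; exact: heq_refl.
Qed.

End Heq.

Notation "f '\wr' t" := (f \hx (id2 t : arr2 t t)) (at level 40) : twocat_scope.
Notation "r '\wl' f" := ((id2 r : arr2 r r) \hx f) (at level 40) : twocat_scope.

(** * Solutions of the conjugation equations as units of adjunctions *)

Section Cup.
Variables (R : realType) (C : twoCstarCat R).

Fact cup_key : unit. Proof. exact: tt. Qed.

(* S (x) 1_t with its target bracketed to the right.  Read this way, a solution
   of the conjugation equations is a unit of an adjunction between the functors
   r (x) - and rb (x) -, and no associator is left in the computations.  It is
   locked because rewriting would otherwise see through it. *)
Definition cup {D B A : C} {a : arr A B} {b : arr B A}
    (S : arr2 (unit1 A) (a \ox b)) (t : arr A D) : arr2 t (a \ox (b \ox t)) :=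
  locked_with cup_key
    (idto (tensA a b t) \vo (S \wr t) \vo idto (esym (tens1l t))).

Lemma cupE {D B A : C} {a : arr A B} {b : arr B A}
    (S : arr2 (unit1 A) (a \ox b)) (t : arr A D) :
  cup S t = idto (tensA a b t) \vo (S \wr t) \vo idto (esym (tens1l t)).
Proof. by rewrite /cup unlock. Qed.

Lemma heq_cup {D B A : C} {a : arr A B} {b : arr B A}
    (S : arr2 (unit1 A) (a \ox b)) (t : arr A D) : heq (cup S t) (S \wr t).
Proof. rewrite cupE; apply: heq_idtor; apply: heq_idtol; exact: heq_refl. Qed.

(** Tensoring with a unit 1-arrow changes nothing up to strictness, so equations between 2-arrows
    out of a unit can be proved in the [cup] calculus. *)
Lemma cup_inj {B A : C} {a : arr A B} {b : arr B A}
    (S T : arr2 (unit1 A) (a \ox b)) :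
  cup S (unit1 A) = cup T (unit1 A) -> S = T.
Proof.
move=> ST; apply: heq_eq.
apply: heq_trans (heq_sym (heq_hcomp1r _)) _.
apply: heq_trans (heq_sym (heq_cup _ _)) _; rewrite ST.
apply: heq_trans (heq_cup _ _) (heq_hcomp1r _).
Qed.

Lemma wr_inj {B A : C} {r s : arr B A} (S T : arr2 r s) :
  S \wr unit1 A = T \wr unit1 A -> S = T.
Proof.
move=> ST; apply: heq_eq.
by apply: heq_trans (heq_sym (heq_hcomp1r _)) _; rewrite ST; exact: heq_hcomp1r.
Qed.

Section CupTheory.
Context {D B A : C} {a : arr A B} {b : arr B A}.
Implicit Type S : arr2 (unit1 A) (a \ox b).

Lemma cup_nat S {t t' : arr A D} (f : arr2 t t') :
  cup S t' \vo f = (a \wl (b \wl f)) \vo cup S t.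
Proof.
apply: heq_eq.
apply: heq_trans (heq_vcomp (heq_cup _ _) (heq_sym (heq_hcomp1l _))) _.
rewrite hv v1r v1l -{1}[S]v1l -[f in S' in heq S' _]v1r -hv -h11.
by apply: heq_vcomp; [exact: heq_hcompA | exact/heq_sym/heq_cup].
Qed.

Lemma cup_comp S {a' : arr A B} {b' : arr B A} (f : arr2 a a') (g : arr2 b b')
    (t : arr A D) :
  cup ((f \hx g) \vo S) t = (f \hx (g \wr t)) \vo cup S t.
Proof.
apply: heq_eq; apply: heq_trans (heq_cup _ _) _.
rewrite -[id2 t in X in heq X _]v1l -hv.
by apply: heq_vcomp; [exact: heq_hcompA | exact/heq_sym/heq_cup].
Qed.

Lemma cup_sum I (u : seq I) P (F : I -> arr2 (unit1 A) (a \ox b)) (t : arr A D) :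
  cup (\sum_(i <- u | P i) F i) t = \sum_(i <- u | P i) cup (F i) t.
Proof.
by rewrite cupE h_suml v_sumr v_suml; apply: eq_bigr => i _; rewrite cupE.
Qed.

Lemma cup0 (t : arr A D) : cup (0 : arr2 (unit1 A) (a \ox b)) t = 0.
Proof. by rewrite !cupE h0l v0r v0l. Qed.
End CupTheory.

(** Up to strictness, the conjugation equation is the triangle identity of the adjunction at the
    unit 1-arrow. *)
Lemma conj_eqP {B A : C} {r : arr B A} {rb : arr A B}
    (Rr : arr2 (unit1 A) (rb \ox r)) (Rb : arr2 (unit1 B) (r \ox rb)) :
  conj_eq Rr Rb <->
  dag (cup Rb (r \ox unit1 A)) \vo (r \wl cup Rr (unit1 A)) = id2 _.
Proof.
have E : heq (idto (tens1l r) \vo (dag Rb \hx id2 r)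
    \vo idto (esym (tensA r rb r)) \vo (id2 r \hx Rr) \vo idto (esym (tens1r r)))
    (dag (cup Rb (r \ox unit1 A)) \vo (r \wl cup Rr (unit1 A))).
  apply: heq_idtor; apply: heq_vcomp.
    apply: heq_idtor; apply: heq_idtol; rewrite -{1}[id2 r]dag1 -dagh.
    apply: heq_dag; apply: heq_trans (heq_sym (heq_cup _ _)).
    by apply: heq_hcomp (heq_refl _) (heq_id2 _); rewrite tens1r.
  apply: heq_hcomp (heq_refl _) _.
  exact: heq_trans (heq_sym (heq_hcomp1r _)) (heq_sym (heq_cup _ _)).
rewrite /conj_eq; split=> E1.
  apply: heq_eq; apply: heq_trans (heq_sym E) _; rewrite E1.
  by apply: heq_id2; rewrite tens1r.
apply: heq_eq; apply: heq_trans E _; rewrite E1.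
by apply: heq_id2; rewrite tens1r.
Qed.

(** Tensoring the triangle identity at the unit 1-arrow with [t] on the right gives it at [t]. *)
Lemma conj_cup {D B A : C} {r : arr B A} {rb : arr A B}
    {Rr : arr2 (unit1 A) (rb \ox r)} {Rb : arr2 (unit1 B) (r \ox rb)} :
  conj_eq Rr Rb -> forall t : arr A D,
  dag (cup Rb (r \ox t)) \vo (r \wl cup Rr t) = id2 _.
Proof.
move=> /conj_eqP E t; apply: heq_eq.
have Et : unit1 A \ox t = t by rewrite tens1l.
apply: (@heq_trans _ _ _ _ _ _ _ _ _ _ _ (((dag (cup Rb (r \ox unit1 A))
    \vo (r \wl cup Rr (unit1 A)))) \wr t)); last first.
  by rewrite E h11; apply: heq_id2; rewrite tensA tens1l.
rewrite -[id2 t]v1l -hv; apply: heq_sym; apply: heq_vcomp.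
  rewrite -[id2 t]dag1 -dagh; apply: heq_dag.
  apply: heq_trans (heq_hcomp (heq_cup _ _) (heq_refl _)) _.
  apply: heq_trans (heq_hcompA _ _ _) _.
  apply: heq_trans (heq_sym (heq_cup _ _)).
  apply: heq_hcomp (heq_refl _) _; rewrite h11; apply: heq_id2.
  by rewrite tensA tens1l.
apply: heq_trans (heq_hcompA _ _ _) _; apply: heq_hcomp (heq_refl _) _.
apply: heq_trans (heq_hcomp (heq_cup _ _) (heq_refl _)) _.
apply: heq_trans (heq_hcompA _ _ _) _.
apply: heq_trans (heq_hcomp (heq_refl _) (heq_hcomp1l _)) _.
exact/heq_sym/heq_cup.
Qed.

End Cup.

(** * Actions of the endomorphisms of the unit 1-arrows *)

Section Scalars.
Variables (R : realType) (C : twoCstarCat R).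

Lemma heq_lact {B A : C} (r : arr B A) (w : arr2 (unit1 B) (unit1 B)) :
  heq (lact r w) (w \wr r).
Proof. apply: heq_idtor; apply: heq_idtol; exact: heq_refl. Qed.

Lemma heq_ract {B A : C} (r : arr B A) (z : arr2 (unit1 A) (unit1 A)) :
  heq (ract r z) (r \wl z).
Proof. apply: heq_idtor; apply: heq_idtol; exact: heq_refl. Qed.

Lemma lact_unit {A : C} (z : arr2 (unit1 A) (unit1 A)) : lact (unit1 A) z = z.
Proof. by apply: heq_eq; apply: heq_trans (heq_lact _ _) (heq_hcomp1r _). Qed.

Lemma ract_unit {A : C} (z : arr2 (unit1 A) (unit1 A)) : ract (unit1 A) z = z.
Proof. by apply: heq_eq; apply: heq_trans (heq_ract _ _) (heq_hcomp1l _). Qed.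

Lemma lact_tens {X B A : C} (s : arr X B) (r : arr B A) w :
  lact (s \ox r) w = lact s w \wr r.
Proof.
apply: heq_eq; apply: heq_trans (heq_lact _ _) _; apply: heq_sym.
apply: heq_trans (heq_hcomp (heq_lact _ _) (heq_refl _)) _.
by apply: heq_trans (heq_hcompA _ _ _) _; rewrite h11; exact: heq_refl.
Qed.

Lemma ract_tens {X B A : C} (s : arr X B) (r : arr B A) z :
  ract (s \ox r) z = s \wl ract r z.
Proof.
apply: heq_eq; apply: heq_trans (heq_ract _ _) _; apply: heq_sym.
apply: heq_trans (heq_hcomp (heq_refl _) (heq_ract _ _)) _.
by apply: heq_trans (heq_sym (heq_hcompA _ _ _)) _; rewrite h11; exact: heq_refl.
Qed.

Lemma ract_lact {X B A : C} (s : arr X B) (r : arr B A) z :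
  ract s z \wr r = s \wl lact r z.
Proof.
apply: heq_eq; apply: heq_trans (heq_hcomp (heq_ract _ _) (heq_refl _)) _.
apply: heq_trans (heq_hcompA _ _ _) _.
exact: heq_hcomp (heq_refl _) (heq_sym (heq_lact _ _)).
Qed.

(** The scalar and [f] live on different tensor factors, so they commute by interchange. In
    particular scalars are central in the endomorphisms of [r]. *)
Lemma lact_nat {B A : C} {r s : arr B A} w (f : arr2 r s) :
  lact s w \vo f = f \vo lact r w.
Proof.
apply: heq_eq.
apply: heq_trans (heq_vcomp (heq_lact _ _) (heq_sym (heq_hcomp1l f))) _.
apply: heq_sym.
apply: heq_trans (heq_vcomp (heq_sym (heq_hcomp1l f)) (heq_lact _ _)) _.
by rewrite !hv !v1l !v1r; exact: heq_refl.
Qed.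

Lemma ract_nat {B A : C} {r s : arr B A} z (f : arr2 r s) :
  ract s z \vo f = f \vo ract r z.
Proof.
apply: heq_eq.
apply: heq_trans (heq_vcomp (heq_ract _ _) (heq_sym (heq_hcomp1r f))) _.
apply: heq_sym.
apply: heq_trans (heq_vcomp (heq_sym (heq_hcomp1r f)) (heq_ract _ _)) _.
by rewrite !hv !v1l !v1r; exact: heq_refl.
Qed.

Lemma lact_comp {B A : C} (r : arr B A) w w' :
  lact r (w \vo w') = lact r w \vo lact r w'.
Proof.
apply: heq_eq; apply: heq_trans (heq_lact _ _) _.
apply: heq_trans (heq_sym (heq_vcomp (heq_lact r _) (heq_lact r _))).
by rewrite hv v1l; exact: heq_refl.
Qed.

Lemma ract_comp {B A : C} (r : arr B A) z z' :
  ract r (z \vo z') = ract r z \vo ract r z'.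
Proof.
apply: heq_eq; apply: heq_trans (heq_ract _ _) _.
apply: heq_trans (heq_sym (heq_vcomp (heq_ract r _) (heq_ract r _))).
by rewrite hv v1l; exact: heq_refl.
Qed.

Lemma lactB {B A : C} (r : arr B A) w w' : lact r (w - w') = lact r w - lact r w'.
Proof. by rewrite /lact hBl vBr vBl. Qed.

Lemma ractB {B A : C} (r : arr B A) z z' : ract r (z - z') = ract r z - ract r z'.
Proof. by rewrite /ract hBr vBr vBl. Qed.

Lemma lact0 {B A : C} (r : arr B A) : lact r 0 = 0.
Proof. by rewrite -[in LHS](subrr 0) lactB subrr. Qed.

Lemma ract0 {B A : C} (r : arr B A) : ract r 0 = 0.
Proof. by rewrite -[in LHS](subrr 0) ractB subrr. Qed.

Lemma ract_solution {B A : C} {r : arr B A} {rb : arr A B}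
    (Rr : arr2 (unit1 A) (rb \ox r)) z :
  (rb \wl ract r z) \vo Rr = Rr \vo z.
Proof. by rewrite -ract_tens ract_nat ract_unit. Qed.

Lemma lact_solution {B A : C} {r : arr B A} {rb : arr A B}
    (Rr : arr2 (unit1 A) (rb \ox r)) z :
  (lact rb z \wr r) \vo Rr = Rr \vo z.
Proof. by rewrite -lact_tens lact_nat lact_unit. Qed.

End Scalars.

(** * Calculus of whiskering *)

Section Whiskering.
Variables (R : realType) (C : twoCstarCat R).

Lemma wl_comp {X B A : C} (s : arr X B) {r r' r'' : arr B A}
    (f : arr2 r' r'') (g : arr2 r r') : s \wl (f \vo g) = (s \wl f) \vo (s \wl g).
Proof. by rewrite hv v1l. Qed.

Lemma wr_comp {X B A : C} {s s' s'' : arr X B} (r : arr B A)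
    (f : arr2 s' s'') (g : arr2 s s') : (f \vo g) \wr r = (f \wr r) \vo (g \wr r).
Proof. by rewrite hv v1l. Qed.

Lemma dag_wl {X B A : C} (s : arr X B) {r r' : arr B A} (f : arr2 r r') :
  dag (s \wl f) = s \wl dag f.
Proof. by rewrite dagh dag1. Qed.

Lemma dag_wr {X B A : C} {s s' : arr X B} (r : arr B A) (f : arr2 s s') :
  dag (f \wr r) = dag f \wr r.
Proof. by rewrite dagh dag1. Qed.

Lemma wr_wl {X B A : C} {s s' : arr X B} {r r' : arr B A}
    (f : arr2 s s') (g : arr2 r r') : (f \wr r') \vo (s \wl g) = f \hx g.
Proof. by rewrite hv v1l v1r. Qed.

Lemma wl_wr {X B A : C} {s s' : arr X B} {r r' : arr B A}
    (f : arr2 s s') (g : arr2 r r') : (s' \wl g) \vo (f \wr r) = f \hx g.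
Proof. by rewrite hv v1l v1r. Qed.

Lemma heq_cup_tens {D E B A : C} {a : arr A B} {b : arr B A}
    (S : arr2 (unit1 A) (a \ox b)) (t : arr A D) (u : arr D E) :
  heq (cup S t \wr u) (cup S (t \ox u)).
Proof.
apply: heq_trans (heq_hcomp (heq_cup _ _) (heq_refl _)) _.
apply: heq_trans (heq_hcompA _ _ _) _; rewrite h11.
exact/heq_sym/heq_cup.
Qed.

Lemma cup_dag_nat {D B A : C} {a : arr A B} {b : arr B A}
    (S : arr2 (unit1 A) (a \ox b)) {t t' : arr A D} (f : arr2 t t') :
  dag (cup S t') \vo (a \wl (b \wl f)) = f \vo dag (cup S t).
Proof.
have /(congr1 dag) := cup_nat S (dag f).
by rewrite !dagv !dag_wl dagKK.
Qed.
End Whiskering.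

(** * Transposition along solutions *)

Section Transposition.
Variables (R : realType) (C : twoCstarCat R) (B A : C).
Variables (r s : arr B A) (rb sb : arr A B).
Variables (Rr : arr2 (unit1 A) (rb \ox r)) (Rb : arr2 (unit1 B) (r \ox rb)).
Variables (Sr : arr2 (unit1 A) (sb \ox s)) (Sb : arr2 (unit1 B) (s \ox sb)).

Fact transpose_key : unit. Proof. exact: tt. Qed.

(** The mate of [X] under the two adjunctions: a leg [rb] is created by [Rr], [X] is applied, and
    [s \ox sb] is closed by [dag Sb]. *)
Definition transpose (X : arr2 r s) : arr2 sb rb :=
  locked_with transpose_key (idto (tens1r rb) \vo
    (dag (rb \wl Sb) \vo (rb \wl (X \wr sb)) \vo cup Rr sb)).

(** Whiskered on the right, the mate is free of strictness isomorphisms; later computations use only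
    this form. *)
Lemma transpose_wr (X : arr2 r s) {D : C} (u : arr B D) :
  transpose X \wr u =
  (rb \wl dag (cup Sb u)) \vo (rb \wl (X \wr (sb \ox u))) \vo cup Rr (sb \ox u).
Proof.
apply: heq_eq; rewrite /transpose unlock.
apply: heq_trans (heq_hcomp (heq_idtol _ (heq_refl _)) (heq_refl _)) _.
rewrite 2!wr_comp; apply: heq_vcomp; last exact: heq_cup_tens.
apply: heq_vcomp.
  rewrite -dag_wr -dag_wl; apply: heq_dag; apply: heq_trans (heq_hcompA _ _ _) _.
  exact: heq_hcomp (heq_refl _) (heq_sym (heq_cup _ _)).
apply: heq_trans (heq_hcompA _ _ _) _; apply: heq_hcomp (heq_refl _) _.
by apply: heq_trans (heq_hcompA _ _ _) _; rewrite h11; exact: heq_refl.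
Qed.

Hypothesis RS : conj_eq Rr Rb.

(** Expanding the mate produces a zigzag of [Rr] and [Rb], which the triangle identity straightens.
    Thus [X] slides around the cap. *)
Lemma transpose_counit (X : arr2 r s) :
  dag Sb \vo (X \wr sb) = dag Rb \vo (r \wl transpose X).
Proof.
apply: dag_inj; rewrite !dagv !dagKK.
apply: cup_inj; rewrite dag_wr dag_wl !cup_comp h11.
set u := unit1 B; apply: dag_inj; rewrite !dagv.
rewrite dag_wl !dag_wr !dagKK transpose_wr !wl_comp !vA.
rewrite cup_dag_nat -!vA (vA (dag (cup Rb _))) cup_dag_nat.
by rewrite -!vA (conj_cup RS) v1r.
Qed.

Lemma conj_cup_eq0 {D : C} (X : arr2 r s) (t : arr A D) :
  (rb \wl (X \wr t)) \vo cup Rr t = 0 -> X \wr t = 0.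
Proof.
move=> X0; rewrite -[LHS]v1r -(conj_cup RS) vA -cup_dag_nat -vA.
by rewrite -wl_comp X0 h0r v0r.
Qed.

(** Bending the leg back with [Rb] recovers [X]. *)
Lemma solution_faithful (X : arr2 r s) : (rb \wl X) \vo Rr = 0 -> X = 0.
Proof.
move=> X0; apply: wr_inj; rewrite h0l; apply: conj_cup_eq0.
by rewrite -cup_comp X0 cup0.
Qed.

Hypothesis SS : conj_eq Sr Sb.

Lemma transpose_unit (X : arr2 r s) :
  (rb \wl X) \vo Rr = (transpose X \wr s) \vo Sr.
Proof.
apply: cup_inj; rewrite !cup_comp h11; set t := unit1 A.
rewrite transpose_wr -!vA cup_nat (vA (rb \wl (X \wr _))).
rewrite -wl_comp wr_wl -(wl_wr X (cup Sr t)) wl_comp -vA vA.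
by rewrite -wl_comp (conj_cup SS) h11 v1l.
Qed.

End Transposition.

(** * Left and right inverses defined by a solution *)

Section LeftRightInverse.
Variables (R : realType) (C : twoCstarCat R).

(** The unnormalised left inverse of [r]; [rphi] is the right one. Standardness for balanced [r]
    says that they agree after acting on [r]. *)
Definition lphi {B A : C} {r : arr B A} {rb : arr A B}
    (Rr : arr2 (unit1 A) (rb \ox r)) (X : arr2 r r) : arr2 (unit1 A) (unit1 A) :=
  dag Rr \vo (id2 rb \hx X) \vo Rr.

Definition rphi {B A : C} {r : arr B A} {rb : arr A B}
    (Rb : arr2 (unit1 B) (r \ox rb)) (X : arr2 r r) : arr2 (unit1 B) (unit1 B) :=
  dag Rb \vo (X \hx id2 rb) \vo Rb.

Context {B A : C} {r : arr B A} {rb : arr A B}.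
Variables (Rr : arr2 (unit1 A) (rb \ox r)) (Rb : arr2 (unit1 B) (r \ox rb)).

Lemma lphiB X Y : lphi Rr (X - Y) = lphi Rr X - lphi Rr Y.
Proof. by rewrite /lphi hBr vBr vBl. Qed.

Lemma lphi0 : lphi Rr 0 = 0.
Proof. by rewrite /lphi h0r v0r v0l. Qed.

Lemma rphi0 : rphi Rb 0 = 0.
Proof. by rewrite /rphi h0l v0r v0l. Qed.

Lemma lphi_ract X z : lphi Rr (X \vo ract r z) = lphi Rr X \vo z.
Proof. by rewrite /lphi wl_comp -!vA ract_solution. Qed.

Lemma rphi_lact X w : rphi Rb (X \vo lact r w) = rphi Rb X \vo w.
Proof. by rewrite /rphi wr_comp -!vA lact_solution. Qed.

Lemma dag_lphi X : dag (lphi Rr X) = lphi Rr (dag X).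
Proof. by rewrite /lphi !dagv dagKK dag_wl vA. Qed.

(** The left inverse of [dag X \vo X] is [dag Z \vo Z] for [Z := (rb \wl X) \vo Rr], so the
    C*-identity gives [Z = 0]. *)
Lemma lphi_faithful {s : arr B A} (X : arr2 r s) :
  conj_eq Rr Rb -> lphi Rr (dag X \vo X) = 0 -> X = 0.
Proof.
move=> RS X0; apply: (solution_faithful RS); apply: dagv_eq0.
by rewrite dagv dag_wl !vA -(vA (dag Rr)) -wl_comp.
Qed.
End LeftRightInverse.

(** * Transposition between centrally balanced 1-arrows *)

Section BalancedTransposition.
Variables (R : realType) (C : twoCstarCat R) (hdsum : closed_under_dsums C).
Variables (B A : C) (r s : arr B A) (rb sb : arr A B).
Variables (Rr : arr2 (unit1 A) (rb \ox r)) (Rb : arr2 (unit1 B) (r \ox rb)).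
Variables (Sr : arr2 (unit1 A) (sb \ox s)) (Sb : arr2 (unit1 B) (s \ox sb)).
Hypothesis (Rsol : is_solution Rr Rb) (Ssol : is_solution Sr Sb).

(* X1 is the image of X under a (not necessarily * -preserving) map that plays
   the role of the modular automorphism of the left inverses, and of its inverse
   for the right inverses. *)
Lemma modular_ex (X : arr2 r s) : exists X1 : arr2 r s,
  [/\ forall Z : arr2 s r, lphi Sr (X \vo Z) = lphi Rr (Z \vo X1),
      forall Z : arr2 s r, rphi Rb (Z \vo X) = rphi Sb (X1 \vo Z)
    & exists Y : arr2 sb rb, (rb \wl X1) \vo Rr = (Y \wr s) \vo Sr /\
        (sb \wl dag X) \vo Sr = (dag Y \wr r) \vo Rr].
Proof.
case: Rsol Ssol => RS RS' [SS SS'].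
(* [dag X] is transposed to [Y], and [Y] along the conjugate solutions to [X']. The required [X1] is
   [dag X']; it would be [X] if transposition commuted with [dag]. *)
have V1 := transpose_unit Sr RS (dag X).
have V2 := transpose_counit Rb SS (dag X).
set Y := transpose _ _ _ in V1 V2.
have W1 := transpose_unit Rb SS' Y.
have W2 := transpose_counit Sr RS' Y.
set X' := transpose _ _ _ in W1 W2.
have {}V1' : dag Sr \vo (sb \wl X) = dag Rr \vo (dag Y \wr r).
  by apply: dag_inj; rewrite !dagv dag_wl dag_wr !dagKK.
have {}V2 : (X \wr rb) \vo Rb = (s \wl dag Y) \vo Sb.
  by apply: dag_inj; rewrite !dagv dag_wl dag_wr !dagKK.
have {}W1 : dag Rb \vo (r \wl dag Y) = dag Sb \vo (dag X' \wr sb).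
  by apply: dag_inj; rewrite !dagv dag_wl dag_wr !dagKK.
have {}W2 : (dag Y \wr s) \vo Sr = (rb \wl dag X') \vo Rr.
  by apply: dag_inj; rewrite !dagv dag_wl dag_wr !dagKK.
exists (dag X'); split; last by exists (dag Y); rewrite W2 dagKK.
  move=> Z; rewrite /lphi wl_comp vA V1' -(vA (dag Rr)) wr_wl -wl_wr.
  by rewrite -!vA W2 wl_comp -!vA.
move=> Z; rewrite /rphi wr_comp -!vA V2 (vA (Z \wr rb)) wr_wl -wl_wr !vA W1.
by rewrite wr_comp !vA.
Qed.

Hypothesis Rstd :
  forall X : arr2 r r, ract r (lphi Rr X) = lact r (rphi Rb X).
Hypothesis Sstd :
  forall X : arr2 s s, ract s (lphi Sr X) = lact s (rphi Sb X).

(** For [D := X2 - X0], the two standardness conditions turn right inverses into left ones, whence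
    [z := lphi Rr (dag D \vo D)] acts as zero on [D]. So [z \vo z = 0]; as [z] is self-adjoint it
    vanishes, and faithfulness gives [D = 0]. *)
Lemma modular_square (X0 X1 X2 : arr2 r s) :
  (forall Z : arr2 s r, rphi Rb (Z \vo X0) = rphi Sb (X1 \vo Z)) ->
  (forall Z : arr2 s r, lphi Sr (X1 \vo Z) = lphi Rr (Z \vo X2)) ->
  X2 = X0.
Proof.
move=> E01 E12; apply/eqP; rewrite -subr_eq0; apply/eqP.
set D := X2 - X0; set z := lphi Rr (dag D \vo D).
have Dz : D \vo ract r z = 0.
  rewrite /z {2}/D vBr lphiB ractB vBr; apply/eqP; rewrite subr_eq0; apply/eqP.
  by rewrite -E12 Rstd E01 -lact_nat -Sstd ract_nat.
apply: (lphi_faithful Rsol.1); rewrite -/z; apply: selfadj_sq_eq0.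
  by rewrite /z dag_lphi dagv dagKK.
by rewrite -{1}/z -lphi_ract -vA Dz v0r lphi0.
Qed.

(** The two equations together say that transposition commutes with [dag]; by [modular_ex] this
    amounts to [X1 = X]. *)
Lemma balanced_transpose (X : arr2 r s) : exists Y : arr2 sb rb,
  (rb \wl X) \vo Rr = (Y \wr s) \vo Sr /\
  (sb \wl dag X) \vo Sr = (dag Y \wr r) \vo Rr.
Proof.
have [X1 [l1 r1 [Y [Y1 Y2]]]] := modular_ex X; have [X2 [l2 r2 _]] := modular_ex X1.
have E2 := modular_square r1 l2; rewrite {}E2 {X2} in l2 r2.
suff EX : X1 = X by exists Y; rewrite -[in LHS]EX.
(* The modular map exchanges [X] and [X1], so it sends [D] to [- D]. Taking [Z := dag D] below, two
   positive terms add up to zero. *)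
apply/eqP; rewrite -subr_eq0; apply/eqP; set D := X1 - X.
have DZ Z : lphi Sr (D \vo Z) = - lphi Rr (Z \vo D).
  by rewrite vBl vBr !lphiB l1 l2 opprB.
apply: (solution_faithful Rsol.1).
apply: (dagv_add_eq0 hdsum (V := (sb \wl dag D) \vo Sr)).
rewrite !dagv !dag_wl dagKK.
transitivity (lphi Rr (dag D \vo D) + lphi Sr (D \vo dag D)).
  by rewrite /lphi !wl_comp !vA.
by rewrite DZ subrr.
Qed.

End BalancedTransposition.

(** * Direct sums *)

Section DirectSums.
Variables (R : realType) (C : twoCstarCat R).

Lemma ract_sum {B A : C} (r : arr B A) I (u : seq I) P F :
  ract r (\sum_(i <- u | P i) F i) = \sum_(i <- u | P i) ract r (F i).
Proof. by rewrite /ract h_sumr v_sumr v_suml. Qed.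

Lemma lact_sum {B A : C} (r : arr B A) I (u : seq I) P F :
  lact r (\sum_(i <- u | P i) F i) = \sum_(i <- u | P i) lact r (F i).
Proof. by rewrite /lact h_suml v_sumr v_suml. Qed.

(** [is_dsum] over any finite type: combined decompositions are indexed by dependent pairs or by
    products. *)
Definition is_fdsum {B A : C} {I : finType} (r_ : I -> arr B A) (r : arr B A)
    (W : forall i, arr2 (r_ i) r) : Prop :=
  [/\ forall i, is_isometry (W i),
      forall i j, i != j -> dag (W i) \vo W j = 0
    & \sum_i (W i \vo dag (W i)) = id2 r].

Section Family.
Context {B A : C} {I : finType} {r_ : I -> arr B A} {r : arr B A}.
Variable W : forall i, arr2 (r_ i) r.
Hypothesis Wsum : is_fdsum W.

Lemma dsum_pick {t : arr B A} (F : forall i, arr2 (r_ i) t) j :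
  (\sum_i (F i \vo dag (W i))) \vo W j = F j.
Proof.
have [Wi Wo _] := Wsum.
rewrite v_suml (bigD1 j) //= -vA (Wi j) v1r big1 ?addr0 // => i ij.
by rewrite -vA Wo // v0r.
Qed.

Lemma dsum_expand {t : arr B A} (f : arr2 t r) :
  f = \sum_i (W i \vo (dag (W i) \vo f)).
Proof.
have [_ _ W1] := Wsum; rewrite -{1}[f]v1l -W1 v_suml.
by apply: eq_bigr => i _; rewrite vA.
Qed.

Definition fdsum_sol {rb_ : I -> arr A B} {rb : arr A B}
    (Wb : forall i, arr2 (rb_ i) rb)
    (R_ : forall i, arr2 (unit1 A) (rb_ i \ox r_ i)) :
    arr2 (unit1 A) (rb \ox r) :=
  \sum_i ((Wb i \hx W i) \vo R_ i).
End Family.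

Section FamilySolution.
Context {B A : C} {I : finType} {r_ : I -> arr B A} {r : arr B A}.
Context {rb_ : I -> arr A B} {rb : arr A B}.
Variables (W : forall i, arr2 (r_ i) r) (Wb : forall i, arr2 (rb_ i) rb).
Hypotheses (Wsum : is_fdsum W) (Wbsum : is_fdsum Wb).
Variable R_ : forall i, arr2 (unit1 A) (rb_ i \ox r_ i).

(** Transposition works on matrix entries and exchanges their indices: the block from [r_ j] to
    [r_ i] gives one from [rb_ i] to [rb_ j]. *)
Lemma fdsum_sol_transpose (X : arr2 r r) (Y : forall i j, arr2 (rb_ i) (rb_ j)) :
  (forall i j, (rb_ j \wl (dag (W i) \vo X \vo W j)) \vo R_ j =
               (Y i j \wr r_ i) \vo R_ i) ->
  (rb \wl X) \vo fdsum_sol W Wb R_ =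
  ((\sum_i ((\sum_j (Wb j \vo Y i j)) \vo dag (Wb i))) \wr r)
    \vo fdsum_sol W Wb R_.
Proof.
move=> XY; rewrite !v_sumr.
transitivity (\sum_j \sum_i ((Wb j \hx W i) \vo ((Y i j \wr r_ i) \vo R_ i))).
  apply: eq_bigr => j _; rewrite vA hv v1l (dsum_expand Wsum (X \vo W j)).
  rewrite h_sumr v_suml; apply: eq_bigr => i _.
  by rewrite -XY !vA hv v1r !vA.
rewrite exchange_big; apply: eq_bigr => i _ /=.
rewrite vA hv v1l (dsum_pick Wbsum) h_suml v_suml; apply: eq_bigr => j _.
by rewrite vA hv v1r.
Qed.

(** Orthogonality of the [Wb] kills the cross terms, so only the diagonal blocks of [X] survive. *)
Lemma lphi_fdsum (X : arr2 r r) :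
  lphi (fdsum_sol W Wb R_) X = \sum_i lphi (R_ i) (dag (W i) \vo X \vo W i).
Proof.
have [Wbi Wbo _] := Wbsum.
rewrite /lphi dag_sum !v_suml; apply: eq_bigr => i _.
rewrite v_sumr (bigD1 i) //= big1 ?addr0.
  by rewrite dagv dagh !vA -!(vA (dag (R_ i))) !hv v1r (Wbi i) !vA.
move=> j ji; rewrite dagv dagh !vA -!(vA (dag (R_ i))) !hv v1r Wbo 1?eq_sym //.
by rewrite h0l v0l v0r.
Qed.

Lemma rphi_fdsum (Rb_ : forall i, arr2 (unit1 B) (r_ i \ox rb_ i)) (X : arr2 r r) :
  rphi (fdsum_sol Wb W Rb_) X = \sum_i rphi (Rb_ i) (dag (W i) \vo X \vo W i).
Proof.
have [Wbi Wbo _] := Wbsum.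
rewrite /rphi dag_sum !v_suml; apply: eq_bigr => i _.
rewrite v_sumr (bigD1 i) //= big1 ?addr0.
  by rewrite dagv dagh !vA -!(vA (dag (Rb_ i))) !hv v1r (Wbi i) !vA.
move=> j ji; rewrite dagv dagh !vA -!(vA (dag (Rb_ i))) !hv v1r Wbo 1?eq_sym //.
by rewrite h0r v0l v0r.
Qed.

(** Off-diagonal terms vanish by orthogonality of the [Wb]; the [i]-th diagonal term reduces to
    [W i \vo dag (W i)] by the triangle identity, and these sum to the identity. *)
Lemma fdsum_conj_eq (Rb_ : forall i, arr2 (unit1 B) (r_ i \ox rb_ i)) :
  (forall i, conj_eq (R_ i) (Rb_ i)) ->
  conj_eq (fdsum_sol W Wb R_) (fdsum_sol Wb W Rb_).
Proof.
move=> RS; apply/conj_eqP; set t := unit1 A.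
have [Wbi Wbo _] := Wbsum; have [_ _ W1] := Wsum.
rewrite -[RHS]h11 -[in RHS]W1 h_suml !cup_sum dag_sum h_sumr v_suml.
apply: eq_bigr => i _; rewrite v_sumr (bigD1 i) //= big1 ?addr0 => [|j ji].
  rewrite !cup_comp dagv dagh dag_wr wl_comp !vA -(vA (dag (cup _ _))) !hv.
  rewrite v1r v1l Wbi -wl_wr vA cup_dag_nat -!vA wr_wl.
  rewrite -(wl_wr (dag (W i)) (cup (R_ i) t)) (vA (dag (cup _ _))).
  by rewrite (conj_cup (RS i)) v1l -wr_comp.
rewrite !cup_comp dagv dagh dag_wr wl_comp !vA -(vA (dag (cup _ _))) !hv.
by rewrite Wbo 1?eq_sym // h0l h0r v0r v0l.
Qed.
End FamilySolution.

End DirectSums.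

(** * Decompositions of standard solutions, and stability under direct sums *)

Section Decompositions.
Variables (R : realType) (C : twoCstarCat R).

(** The witnesses of [is_standard] as data over a finite type, so that one can be chosen for each
    member of a family and its fields reused. *)
Record decomposition {B A : C} {r : arr B A} {rb : arr A B}
    (Rr : arr2 (unit1 A) (rb \ox r)) (Rb : arr2 (unit1 B) (r \ox rb)) :=
  Decomposition {
    dI : finType;
    dr : dI -> arr B A;
    drb : dI -> arr A B;
    dW : forall i, arr2 (dr i) r;
    dWb : forall i, arr2 (drb i) rb;
    dR : forall i, arr2 (unit1 A) (drb i \ox dr i);
    dRb : forall i, arr2 (unit1 B) (dr i \ox drb i);
    dWsum : is_fdsum dW;
    dWbsum : is_fdsum dWb;
    dbal : forall i, centrally_balanced (dr i) /\ centrally_balanced (drb i);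
    dstd : forall i, is_standard_balanced (dR i) (dRb i);
    dRE : Rr = fdsum_sol dW dWb dR;
    dRbE : Rb = fdsum_sol dWb dW dRb }.

Lemma sum_enum_val (I : finType) (V : nmodType) (F : I -> V) :
  \sum_(k < #|I|) F (enum_val k) = \sum_i F i.
Proof. by rewrite -(big_enum_val (A := I)); apply: eq_bigl. Qed.

Lemma sum_sigma (I : finType) (J : I -> finType) (V : nmodType)
    (F : forall i, J i -> V) :
  \sum_(p : {i : I & J i}) F (tag p) (tagged p) = \sum_i \sum_j F i j.
Proof. by rewrite (sig_big_dep _ _ F). Qed.

Lemma fdsum_enum_val {B A : C} {I : finType} {r_ : I -> arr B A} {r : arr B A}
    (W : forall i, arr2 (r_ i) r) :
  is_fdsum W -> is_dsum (fun k : 'I_#|I| => W (enum_val k)).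
Proof.
case=> Wi Wo W1; split=> [k|k l kl|]; first exact: Wi.
  by apply: Wo; rewrite (inj_eq enum_val_inj).
by rewrite -W1 -[RHS]sum_enum_val.
Qed.

Lemma decomposition_standard {B A : C} {r : arr B A} {rb : arr A B}
    (Rr : arr2 (unit1 A) (rb \ox r)) (Rb : arr2 (unit1 B) (r \ox rb)) :
  decomposition Rr Rb -> is_standard Rr Rb.
Proof.
case=> I r_ rb_ W Wb R_ Rb_ Wsum Wbsum bal std -> ->; split.
  by split; apply: fdsum_conj_eq => // i; case: (std i) => -[].
exists #|I|, (fun k => r_ (enum_val k)), (fun k => rb_ (enum_val k)).
exists (fun k => W (enum_val k)), (fun k => Wb (enum_val k)).
exists (fun k => R_ (enum_val k)), (fun k => Rb_ (enum_val k)).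
split=> [|k|k|]; first by split; apply: fdsum_enum_val.
- exact: bal.
- exact: std.
split; first exact: esym (sum_enum_val (fun i => (Wb i \hx W i) \vo R_ i)).
exact: esym (sum_enum_val (fun i => (W i \hx Wb i) \vo Rb_ i)).
Qed.

Lemma standard_decomposition {B A : C} {r : arr B A} {rb : arr A B}
    (Rr : arr2 (unit1 A) (rb \ox r)) (Rb : arr2 (unit1 B) (r \ox rb)) :
  is_standard Rr Rb -> exists _ : decomposition Rr Rb, True.
Proof.
case=> _ [n [r_ [rb_ [W [Wb [R_ [Rb_ [[Ws Wbs] bal std [RE RbE]]]]]]]]].
by exists (Decomposition (dI := 'I_n) Ws Wbs bal std RE RbE).
Qed.

Lemma fdsum_sigma {B A : C} {I : finType} {J : I -> finType}
    {r_ : I -> arr B A} {q_ : forall i, J i -> arr B A} {r : arr B A}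
    (W : forall i, arr2 (r_ i) r) (V : forall i (j : J i), arr2 (q_ i j) (r_ i)) :
  is_fdsum W -> (forall i, is_fdsum (V i)) ->
  is_fdsum (fun p : {i : I & J i} => W (tag p) \vo V (tag p) (tagged p)).
Proof.
move=> [Wi Wo W1] Vs; split=> [[i j]|[i j] [i' j']|] /=.
- have [Vi _ _] := Vs i.
  by rewrite /is_isometry dagv vA -(vA (dag _)) (Wi i) v1r (Vi j).
- move=> ne; rewrite dagv vA -(vA (dag (V i j))).
  have [e|ii'] := eqVneq i i'; last by rewrite Wo // v0r v0l.
  subst i'; rewrite (Wi i) v1r; have [_ Vo _] := Vs i; apply: Vo.
  by apply: contra ne => /eqP ->.
rewrite -W1 (eq_bigr (fun i => \sum_j (W i \vo V i j \vo dag (W i \vo V i j)))).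
  exact: (sum_sigma (fun i j => W i \vo V i j \vo dag (W i \vo V i j))).
move=> i _; have [_ _ V1] := Vs i.
rewrite -{1}[W i]v1r -V1 v_sumr v_suml; apply: eq_bigr => j _.
by rewrite dagv !vA.
Qed.

(** Refining the outer decomposition by chosen decompositions of the summands expresses the sum
    through balanced pieces indexed by dependent pairs. *)
Lemma standard_dsum {B A : C} (n : nat) (r_ : 'I_n -> arr B A)
    (rb_ : 'I_n -> arr A B) (r : arr B A) (rb : arr A B)
    (W : forall i, arr2 (r_ i) r) (Wb : forall i, arr2 (rb_ i) rb)
    (R_ : forall i, arr2 (unit1 A) (rb_ i \ox r_ i))
    (Rb_ : forall i, arr2 (unit1 B) (r_ i \ox rb_ i)) :
  (forall i, is_standard (R_ i) (Rb_ i)) -> is_dsum W -> is_dsum Wb ->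
  is_standard (dsum_sol W Wb R_) (dsum_sol Wb W Rb_).
Proof.
move=> std Ws Wbs.
pose D i := projT1 (cid (standard_decomposition (std i))).
apply: decomposition_standard.
apply: (Decomposition (dI := {i : 'I_n & dI (D i)})
  (dr := fun p => dr (d := D (tag p)) (tagged p))
  (drb := fun p => drb (d := D (tag p)) (tagged p))
  (dW := fun p => W (tag p) \vo dW (d := D (tag p)) (tagged p))
  (dWb := fun p => Wb (tag p) \vo dWb (d := D (tag p)) (tagged p))
  (dR := fun p => dR (d := D (tag p)) (tagged p))
  (dRb := fun p => dRb (d := D (tag p)) (tagged p))).
- exact: (fdsum_sigma (V := fun i => dW (d := D i)) Ws (fun i => dWsum (D i))).
- exact: (fdsum_sigma (V := fun i => dWb (d := D i)) Wbs (fun i => dWbsum (D i))).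
- by move=> p; exact: dbal.
- by move=> p; exact: dstd.
- apply: etrans _ (esym (sum_sigma (fun i j =>
    ((Wb i \vo dWb (d := D i) j) \hx (W i \vo dW (d := D i) j)) \vo dR (d := D i) j))).
  apply: eq_bigr => i _; rewrite {1}(dRE (D i)) v_sumr.
  by apply: eq_bigr => j _; rewrite vA hv.
apply: etrans _ (esym (sum_sigma (fun i j =>
  ((W i \vo dW (d := D i) j) \hx (Wb i \vo dWb (d := D i) j)) \vo dRb (d := D i) j))).
apply: eq_bigr => i _; rewrite {1}(dRbE (D i)) v_sumr.
by apply: eq_bigr => j _; rewrite vA hv.
Qed.

End Decompositions.

(** * Conjugation and projections *)

Section Conjugation.
Variables (R : realType) (C : twoCstarCat R) (B A : C).
Variables (r : arr B A) (rb : arr A B).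
Variables (Rr : arr2 (unit1 A) (rb \ox r)) (Rb : arr2 (unit1 B) (r \ox rb)).
Hypothesis Rsol : is_solution Rr Rb.

(** The mirror image of [solution_faithful], by the second conjugation equation applied to
    adjoints. *)
Lemma solution_faithful_left {c : arr A B} (Y : arr2 rb c) :
  (Y \wr r) \vo Rr = 0 -> Y = 0.
Proof.
move=> Y0; have H (t : arr A B) : dag (cup Rr t) \vo (dag Y \wr (r \ox t)) = 0.
  apply: dag_inj; rewrite dagv dag_wr !dagKK dag0.
  have := congr1 (fun S => cup S t) Y0.
  by rewrite /= cup_comp h11 cup0.
suff E0 : dag Y = 0 by apply: dag_inj; rewrite E0 dag0.
apply: wr_inj; rewrite h0l; set u := unit1 B.
rewrite -[LHS]v1l -(conj_cup Rsol.2) -vA wl_wr -wr_wl vA.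
by rewrite H v0l.
Qed.

(** A scalar between [rb] and [r] can be read on either factor, and an outer one passes to the
    source of [Rr]. Both sides thus give [Rr \vo z]. *)
Lemma ract_eq_lact_conj z w : ract r z = lact r w -> ract rb w = lact rb z.
Proof.
move=> zw; apply/eqP; rewrite -subr_eq0; apply/eqP; apply: solution_faithful_left.
by rewrite hBl vBl ract_lact lact_solution -zw ract_solution subrr.
Qed.

(** The transpose as a relation; since it determines [Y], identities between transposes follow
    without the formula of [transpose]. *)
Definition transposed (X : arr2 r r) (Y : arr2 rb rb) :=
  (rb \wl X) \vo Rr = (Y \wr r) \vo Rr.

Lemma transposed_uniq X Y Y' : transposed X Y -> transposed X Y' -> Y = Y'.
Proof.
rewrite /transposed => -> /eqP; rewrite -subr_eq0 -vBl -hBl => /eqP.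
by move/solution_faithful_left/eqP; rewrite subr_eq0 => /eqP.
Qed.

Lemma transposed0 : transposed 0 0.
Proof. by rewrite /transposed h0l h0r. Qed.

Lemma transposed_comp X Y X' Y' :
  transposed X Y -> transposed X' Y' -> transposed (X \vo X') (Y' \vo Y).
Proof.
rewrite /transposed => XY XY'.
by rewrite wl_comp -vA XY' vA wl_wr -wr_wl -vA XY vA -wr_comp.
Qed.

Lemma transposed_sum (I : finType) (X : I -> arr2 r r) (Y : I -> arr2 rb rb) :
  (forall i, transposed (X i) (Y i)) -> transposed (\sum_i X i) (\sum_i Y i).
Proof.
move=> XY; rewrite /transposed h_sumr h_suml !v_suml.
by apply: eq_bigr => i _; exact: XY.
Qed.

Lemma transposedP X : transposed X (transpose Rr Rb X).
Proof. exact: transpose_unit Rsol.1 X. Qed.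

Lemma transposed_counit X Y :
  transposed X Y -> dag Rb \vo (X \wr rb) = dag Rb \vo (r \wl Y).
Proof.
by move=> /transposed_uniq /(_ (transposedP X)) ->; exact: (transpose_counit Rb Rsol.1).
Qed.

(** This is the adjoint of the counit form of the relation; self-adjointness keeps [X] and [Y]
    unchanged. *)
Lemma transposed_conj X Y :
  dag X = X -> dag Y = Y -> transposed X Y -> (r \wl Y) \vo Rb = (X \wr rb) \vo Rb.
Proof.
move=> Xs Ys /transposed_counit XY; apply: dag_inj.
by rewrite !dagv dag_wl dag_wr Xs Ys XY.
Qed.

End Conjugation.

Lemma is_solution_conj (R : realType) (C : twoCstarCat R) (B A : C)
    (r : arr B A) (rb : arr A B)
    (Rr : arr2 (unit1 A) (rb \ox r)) (Rb : arr2 (unit1 B) (r \ox rb)) :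
  is_solution Rr Rb -> is_solution Rb Rr.
Proof. by case. Qed.

Section Stability.
Variables (R : realType) (C : twoCstarCat R).

Lemma balanced_lact {B A : C} (r : arr B A) w :
  centrally_balanced r -> exists z, lact r w = ract r z.
Proof.
move=> rbal; have : range (lact r) (lact r w) by exists w.
by rewrite rbal => -[z _ <-]; exists z.
Qed.

Lemma balanced_ract {B A : C} (r : arr B A) z :
  centrally_balanced r -> exists w, ract r z = lact r w.
Proof.
move=> rbal; have : range (ract r) (ract r z) by exists z.
by rewrite -rbal => -[w _ <-]; exists w.
Qed.

Lemma balancedP {B A : C} (r : arr B A) :
  (forall w, exists z, lact r w = ract r z) ->
  (forall z, exists w, ract r z = lact r w) -> centrally_balanced r.
Proof.
move=> lr rl; apply/seteqP; split=> _ [x _ <-].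
  by have [z ->] := lr x; exists z.
by have [z ->] := rl x; exists z.
Qed.

Lemma balanced_conj {B A : C} {r : arr B A} {rb : arr A B}
    {Rr : arr2 (unit1 A) (rb \ox r)} {Rb : arr2 (unit1 B) (r \ox rb)} :
  is_solution Rr Rb -> centrally_balanced r -> centrally_balanced rb.
Proof.
move=> RS rbal; apply: balancedP => [z|w].
  by have [w /(ract_eq_lact_conj RS)] := balanced_ract z rbal; exists w.
by have [z /esym/(ract_eq_lact_conj RS)] := balanced_lact w rbal; exists z.
Qed.

(** Transposition identifies the left and right inverses of [rb] with the right and left inverses of
    [r], evaluated at the transpose of [Y]. *)
Lemma standard_balanced_conj {B A : C} {r : arr B A} {rb : arr A B}
    {Rr : arr2 (unit1 A) (rb \ox r)} {Rb : arr2 (unit1 B) (r \ox rb)} :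
  is_standard_balanced Rr Rb -> is_standard_balanced Rb Rr.
Proof.
move=> [RS std]; split=> [|Y]; first exact: is_solution_conj.
have Y1 := transpose_unit Rb RS.2 Y.
have Y2 := transpose_counit Rr RS.2 Y.
rewrite -!vA Y1 (vA (dag Rr)) Y2 !vA.
by apply: (ract_eq_lact_conj RS); exact: std.
Qed.

Lemma standard_conj {B A : C} {r : arr B A} {rb : arr A B}
    (Rr : arr2 (unit1 A) (rb \ox r)) (Rb : arr2 (unit1 B) (r \ox rb)) :
  is_standard Rr Rb -> is_standard Rb Rr.
Proof.
case/standard_decomposition => D _; apply: decomposition_standard.
apply: (Decomposition (dWbsum D) (dWsum D) _ _ (dRbE D) (dRE D)) => i.
  by have [] := dbal i.
exact/standard_balanced_conj/dstd.
Qed.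

(** The blocks of [X] between balanced pieces are transposed by [balanced_transpose], and the
    results are assembled into a matrix. *)
Lemma standard_transpose (hdsum : closed_under_dsums C) {B A : C} {r : arr B A}
    {rb : arr A B} (Rr : arr2 (unit1 A) (rb \ox r))
    (Rb : arr2 (unit1 B) (r \ox rb)) (X : arr2 r r) :
  is_standard Rr Rb ->
  exists Y, transposed Rr X Y /\ transposed Rr (dag X) (dag Y).
Proof.
case/standard_decomposition => -[I r_ rb_ W Wb R_ Rb_ Ws Wbs bal std -> _] _.
pose H i j := cid (balanced_transpose hdsum (std j).1 (std i).1
  (std j).2 (std i).2 (dag (W i) \vo X \vo W j)).
pose Y i j := projT1 (H i j).
have YP i j := projT2 (H i j); rewrite -/(Y _ _) in YP.
exists (\sum_i ((\sum_j (Wb j \vo Y i j)) \vo dag (Wb i))); split.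
  by apply: (fdsum_sol_transpose Ws Wbs) => i j; have [] := YP i j.
(* Blocks of [dag X] are adjoints of blocks of [X] with the indices exchanged, hence so are their
   transposes. *)
rewrite /transposed (fdsum_sol_transpose Ws Wbs (Y := fun i j => dag (Y j i))).
  congr ((_ \wr r) \vo _); rewrite dag_sum.
  under eq_bigr do rewrite v_suml.
  rewrite exchange_big; apply: eq_bigr => i _ /=.
  rewrite dagv dag_sum dagKK v_sumr; apply: eq_bigr => j _.
  by rewrite dagv vA.
move=> i j; have [_ <-] := YP j i.
by rewrite !dagv dagKK vA.
Qed.

(* D := 1_p (x) z - w (x) 1_p is central in End(p), is killed by T, and squares
   to zero because p is centrally balanced. *)
Lemma standard_balanced_through {B A : C} {r p : arr B A} {rb : arr A B}
    (Rr : arr2 (unit1 A) (rb \ox r)) (Rb : arr2 (unit1 B) (r \ox rb))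
    (T : arr2 p r) (S : arr2 r p) :
  is_standard_balanced Rr Rb -> centrally_balanced p ->
  ract p (lphi Rr (T \vo S)) = lact p (rphi Rb (T \vo S)).
Proof.
move=> [_ std] pbal; apply/eqP; rewrite -subr_eq0; apply/eqP.
set z := lphi _ _; set w := rphi _ _; set D := _ - _.
have TD0 : T \vo D = 0.
  by rewrite vBr -ract_nat -lact_nat (std (T \vo S)) subrr.
have [z' z'E] := balanced_lact w pbal.
have DE : D = ract p (z - z') by rewrite /D z'E ractB.
have [w' w'E] := balanced_ract (z - z') pbal.
(* As [D] is itself a right scalar, it can be moved inside the left inverse and then past [S], where
   it meets [T]. For [wD], [D] is rewritten as a left scalar. *)
have zD : ract p z \vo D = 0.
  rewrite DE -ract_comp -lphi_ract -vA -ract_nat -DE vA TD0.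
  by rewrite v0l lphi0 ract0.
have wD : lact p w \vo D = 0.
  rewrite DE w'E -lact_comp -rphi_lact -vA -lact_nat -w'E -DE vA TD0.
  by rewrite v0l rphi0 lact0.
have DD : D \vo D = 0 by rewrite {1}/D vBl zD wD subrr.
(* Centrality gathers the two factors [D] in the square of [dag D \vo D], which is therefore
   zero. *)
apply: dagv_eq0; apply: selfadj_sq_eq0; first by rewrite dagv dagKK.
have Dc (F : arr2 p p) : D \vo F = F \vo D by rewrite DE ract_nat.
by rewrite -vA (vA D) Dc -!vA DD !v0r.
Qed.

(** Only the diagonal blocks of [T \vo S] count, and each of them still factors through [p]. *)
Lemma standard_through {B A : C} {r p : arr B A} {rb : arr A B}
    (Rr : arr2 (unit1 A) (rb \ox r)) (Rb : arr2 (unit1 B) (r \ox rb))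
    (T : arr2 p r) (S : arr2 r p) :
  is_standard Rr Rb -> centrally_balanced p ->
  ract p (lphi Rr (T \vo S)) = lact p (rphi Rb (T \vo S)).
Proof.
case/standard_decomposition => -[I r_ rb_ W Wb R_ Rb_ Ws Wbs bal std -> ->] _ pbal.
rewrite (lphi_fdsum _ Wbs) (rphi_fdsum _ Wbs).
rewrite ract_sum lact_sum; apply: eq_bigr => i _; rewrite !vA -vA.
exact: standard_balanced_through (std i) pbal.
Qed.

Section Compression.
Context {B A : C} {r p : arr B A} {rb pb : arr A B}.
Variables (Rr : arr2 (unit1 A) (rb \ox r)) (Rb : arr2 (unit1 B) (r \ox rb)).
Variables (V : arr2 p r) (Vb : arr2 pb rb).

(** Composing the compressed solutions leaves [Vb \vo dag Vb] on one leg. The last hypothesis moves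
    it to the other leg as [V \vo dag V], which [dag V] absorbs. *)
Lemma conj_eq_compress :
  conj_eq Rr Rb -> is_isometry V ->
  (rb \wl (V \vo dag V)) \vo Rr = ((Vb \vo dag Vb) \wr r) \vo Rr ->
  conj_eq ((dag Vb \hx dag V) \vo Rr) ((dag V \hx dag Vb) \vo Rb).
Proof.
move=> RS Vi VT; apply/conj_eqP; set t := unit1 A.
have VTt : ((Vb \vo dag Vb) \hx (dag V \wr t)) \vo cup Rr t =
    (rb \wl (dag V \wr t)) \vo cup Rr t.
  have /= := congr1 (fun S => cup S t) VT.
  rewrite !cup_comp h11 => E; rewrite -wl_wr -vA -E vA -wl_comp -wr_comp.
  by rewrite vA Vi v1l.
rewrite !cup_comp dagv dagh dag_wr !dagKK wl_comp !vA -(vA (dag (cup _ _))) !hv.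
rewrite v1r v1l -vA hv v1r VTt -(wl_wr V) wl_comp !vA cup_dag_nat.
by rewrite -(vA (dag V \wr t)) (conj_cup RS) v1r -wr_comp Vi h11.
Qed.

Lemma lphi_compress (X : arr2 p p) :
  is_isometry V ->
  (rb \wl (V \vo dag V)) \vo Rr = ((Vb \vo dag Vb) \wr r) \vo Rr ->
  lphi ((dag Vb \hx dag V) \vo Rr) X = lphi Rr (V \vo (X \vo dag V)).
Proof.
move=> Vi VT; rewrite /lphi dagv dagh !dagKK !vA -!(vA (dag Rr)) !hv v1r.
rewrite -(wl_wr (Vb \vo dag Vb)) -vA -VT (vA (rb \wl _)) -wl_comp !vA.
by rewrite -(vA _ (dag V) V) Vi v1r.
Qed.

Lemma rphi_compress (X : arr2 p p) :
  is_isometry V ->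
  (r \wl (Vb \vo dag Vb)) \vo Rb = ((V \vo dag V) \wr rb) \vo Rb ->
  rphi ((dag V \hx dag Vb) \vo Rb) X = rphi Rb (V \vo (X \vo dag V)).
Proof.
move=> Vi VT; rewrite /rphi dagv dagh !dagKK !vA -!(vA (dag Rb)) !hv v1r.
rewrite -(wr_wl _ (Vb \vo dag Vb)) -vA VT (vA (_ \wr rb)) -wr_comp !vA.
by rewrite -(vA _ (dag V) V) Vi v1r.
Qed.
End Compression.

(** [Wb] is an isometry onto the transpose of [W \vo dag W]. Balanced pieces of [rP], viewed in [r],
    have conjugate isometries [u k] into [rb]; transposing their projections shows that the
    [dag Wb \vo u k] decompose [rbP]. *)
Lemma standard_proj (hproj : closed_under_projections C)
    (hdsum : closed_under_dsums C) (hbal : all_dsum_of_centrally_balanced C)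
    {B A : C} (r : arr B A) (rb : arr A B)
    (Rr : arr2 (unit1 A) (rb \ox r)) (Rb : arr2 (unit1 B) (r \ox rb))
    (rP : arr B A) (W : arr2 rP r) :
  is_standard Rr Rb -> is_isometry W ->
  exists (rbP : arr A B) (Wb : arr2 rbP rb),
    is_isometry Wb /\
    is_standard (r := rP) (rb := rbP)
      ((dag Wb \hx dag W) \vo Rr) ((dag W \hx dag Wb) \vo Rb).
Proof.
move=> Rstd Wi; have Rsol := Rstd.1.
have sa X : dag X = X -> exists Y, transposed Rr X Y /\ dag Y = Y.
  move=> Xs; have [Y []] := standard_transpose hdsum X Rstd.
  by rewrite Xs => XY /(transposed_uniq Rsol XY) YY; exists Y.
(* Uniqueness makes the transpose of a range projection a projection, which splits. Source and
   isometry are packed in one pair so that both are chosen at once for each [k]. *)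
have img (q : arr B A) (V : arr2 q r) : is_isometry V ->
    exists (W' : {qb : arr A B & arr2 qb rb}),
      is_isometry (projT2 W') /\
      transposed Rr (V \vo dag V) (projT2 W' \vo dag (projT2 W')).
  move=> Vi; have [|Y [VY Ys]] := sa (V \vo dag V); first by rewrite dagv dagKK.
  have [|qb [Vb [Vbi VbY]]] := hproj _ _ _ Y.
    split=> //; apply: (transposed_uniq Rsol _ VY).
    have := transposed_comp VY VY.
    by rewrite vA -(vA V) Vi v1r.
  by exists (existT _ qb Vb); rewrite /= VbY.
have [[rbP Wb] /= [Wbi WT]] := img _ _ Wi.
exists rbP, Wb; split=> //.
have [n [p_ [v [vs pbal]]]] := hbal _ _ rP; have [vi vo v1] := vs.
have Vi k : is_isometry (W \vo v k).
  by rewrite /is_isometry dagv vA -(vA _ _ W) Wi v1r vi.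
pose Vb k := projT1 (cid (img _ _ (Vi k))).
have VbP k := projT2 (cid (img _ _ (Vi k))); rewrite -/(Vb _) in VbP.
pose pb_ k := projT1 (Vb k); pose u k : arr2 (pb_ k) rb := projT2 (Vb k).
have ui k : is_isometry (u k) by have [] := VbP k.
have uT k : transposed Rr (W \vo v k \vo dag (W \vo v k)) (u k \vo dag (u k)).
  by have [] := VbP k.
have PW k : (W \vo dag W) \vo (W \vo v k) = W \vo v k.
  by rewrite !vA -(vA W) Wi v1r.
(* Transposition reverses products, so subprojections of [W \vo dag W] become subprojections of
   [Wb \vo dag Wb]. *)
have WbU k : (Wb \vo dag Wb) \vo u k = u k.
  rewrite -[u k in LHS]v1r -(ui k) !vA -(vA _ (u k)).
  suff -> : (Wb \vo dag Wb) \vo (u k \vo dag (u k)) = u k \vo dag (u k).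
    by rewrite -vA ui v1r.
  apply: (transposed_uniq Rsol _ (uT k)); have := transposed_comp (uT k) WT.
  suff -> : W \vo v k \vo dag (W \vo v k) \vo (W \vo dag W)
    = W \vo v k \vo dag (W \vo v k) by [].
  by rewrite -vA; congr (_ \vo _); apply: dag_inj; rewrite !dagv !dagKK PW.
have uo k l : k != l -> dag (u k) \vo u l = 0.
  move=> kl.
  suff E : (u k \vo dag (u k)) \vo (u l \vo dag (u l)) = 0.
    rewrite -[LHS]v1l -[LHS]v1r -(ui k) -(ui l).
    transitivity (dag (u k) \vo (u k \vo dag (u k) \vo (u l \vo dag (u l))) \vo u l).
      by rewrite !vA.
    by rewrite E v0r v0l.
  apply: (transposed_uniq Rsol (transposed_comp (uT l) (uT k))).
  suff -> : W \vo v l \vo dag (W \vo v l) \vo (W \vo v k \vo dag (W \vo v k)) = 0.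
    exact: transposed0.
  rewrite !dagv !vA -!(vA _ (dag W) W) Wi v1r -!(vA _ (dag (v l)) (v k)).
  by rewrite vo 1?eq_sym // v0r !v0l.
have Psum : \sum_k (W \vo v k \vo dag (W \vo v k)) = W \vo dag W.
  transitivity (W \vo id2 rP \vo dag W); last by rewrite v1r.
  rewrite -v1 v_sumr v_suml; apply: eq_bigr => k _.
  by rewrite dagv !vA.
have usum : \sum_k (u k \vo dag (u k)) = Wb \vo dag Wb.
  by apply: (transposed_uniq Rsol _ WT); rewrite -Psum; exact: transposed_sum.
have PP k : (W \vo v k \vo dag (W \vo v k)) \vo (W \vo v k \vo dag (W \vo v k)) =
    W \vo v k \vo dag (W \vo v k).
  by rewrite vA -(vA (W \vo v k)) Vi v1r.
have vkP k : dag W \vo (W \vo v k \vo dag (W \vo v k)) = v k \vo dag (W \vo v k).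
  by rewrite !vA Wi v1l.
have ukW k : dag (u k) \vo Wb \vo dag Wb = dag (u k).
  by apply: dag_inj; rewrite !dagv !dagKK vA WbU.
have uT' k : (r \wl (u k \vo dag (u k))) \vo Rb =
    ((W \vo v k \vo dag (W \vo v k)) \wr rb) \vo Rb.
  by apply: (transposed_conj Rsol _ _ (uT k)); rewrite [LHS]dagv dagKK.
have csol k : is_solution ((dag (u k) \hx dag (W \vo v k)) \vo Rr)
    ((dag (W \vo v k) \hx dag (u k)) \vo Rb).
  split; first exact: conj_eq_compress Rsol.1 (Vi k) (uT k).
  exact: conj_eq_compress Rsol.2 (ui k) (uT' k).
apply: decomposition_standard.
apply: (Decomposition (dI := 'I_n) (dr := p_) (drb := pb_) (dW := v)
  (dWb := fun k => dag Wb \vo u k)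
  (dR := fun k => (dag (u k) \hx dag (W \vo v k)) \vo Rr)
  (dRb := fun k => (dag (W \vo v k) \hx dag (u k)) \vo Rb)).
- exact: vs.
- split=> [k|k l kl|].
  + by rewrite /is_isometry dagv dagKK vA -(vA _ Wb) -(vA _ _ (u k)) WbU ui.
  + by rewrite dagv dagKK vA ukW uo.
  under eq_bigr do rewrite dagv dagKK vA -(vA (dag Wb)).
  by rewrite -v_suml -v_sumr usum vA Wbi v1l Wbi.
- move=> k; split; first exact: pbal.
  exact: balanced_conj (csol k) (pbal k).
- move=> k; split=> [|X]; first exact: csol.
  rewrite -/(lphi _ X) -/(rphi _ X).
  (* Both inverses are now evaluated at [T \vo S] with [T := W \vo v k] and [S := X \vo dag T],
     which factors through the balanced [p_ k]. *)
  rewrite (lphi_compress X (Vi k) (uT k)) (rphi_compress X (Vi k) (uT' k)).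
  exact: standard_through.
- transitivity (\sum_k ((dag Wb \hx dag W) \vo
      ((rb \wl (W \vo v k \vo dag (W \vo v k))) \vo Rr))).
    by rewrite -v_sumr -v_suml -h_sumr Psum vA hv v1r vA Wi v1l.
  (* The projection of the [k]-th piece is doubled, and one copy is transposed to
     [u k \vo dag (u k)], so that both legs pass through that piece. *)
  apply: eq_bigr => k _; rewrite -{1}(PP k) wl_comp -vA uT (vA (rb \wl _)) wl_wr.
  by rewrite !vA !hv vkP !vA.
transitivity (\sum_k ((dag W \hx dag Wb) \vo
    (((W \vo v k \vo dag (W \vo v k)) \wr rb) \vo Rb))).
  by rewrite -v_sumr -v_suml -h_suml Psum vA hv v1r vA Wi v1l.
apply: eq_bigr => k _; rewrite -{1}(PP k) wr_comp -vA -uT' (vA (_ \wr rb)) wr_wl.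
by rewrite !vA !hv vkP !vA.
Qed.

End Stability.

(** * Tensor products *)

Section TensorProducts.
Variables (R : realType) (C : twoCstarCat R).

(** Scalars cross [s] and [r] one after the other, through the scalars of the middle object [B]. *)
Lemma balanced_tens {X B A : C} (s : arr X B) (r : arr B A) :
  centrally_balanced s -> centrally_balanced r -> centrally_balanced (s \ox r).
Proof.
move=> sbal rbal; apply: balancedP => [w|z].
  have [z' E] := balanced_lact w sbal; have [z E'] := balanced_lact z' rbal.
  by exists z; rewrite lact_tens E ract_lact E' ract_tens.
have [w' E] := balanced_ract z rbal; have [w E'] := balanced_ract w' sbal.
by exists w; rewrite ract_tens E -ract_lact E' lact_tens.
Qed.

Section TensSol.
Context {X B A : C} {m : arr A B} {a : arr B X} {b : arr X B} {v : arr B A}.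

(** This is the unit of the composite adjunction: the cup of [S] nested inside [T]. *)
Lemma heq_tens_sol (S : arr2 (unit1 B) (a \ox b)) (T : arr2 (unit1 A) (m \ox v)) :
  heq (tens_sol S T) ((m \wl cup S v) \vo T).
Proof.
apply: heq_vcomp (heq_refl _); rewrite -vA -wl_comp; apply: heq_idtol.
apply: heq_hcomp (heq_refl _) _; apply: heq_idtor; exact/heq_sym/heq_cup.
Qed.

Lemma heq_cup_tens_sol {D : C} (S : arr2 (unit1 B) (a \ox b))
    (T : arr2 (unit1 A) (m \ox v)) (t : arr A D) :
  heq (cup (tens_sol S T) t) ((m \wl cup S (v \ox t)) \vo cup T t).
Proof.
apply: heq_trans (heq_cup _ _) _.
apply: heq_trans (heq_hcomp (heq_tens_sol _ _) (heq_refl _)) _.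
rewrite wr_comp; apply: heq_vcomp; last exact/heq_sym/heq_cup.
apply: heq_trans (heq_hcompA _ _ _) _.
exact: heq_hcomp (heq_refl _) (heq_cup_tens _ _ _).
Qed.

End TensSol.

Section TensSolSum.
Context {X B A : C} {m : arr A B} {a : arr B X} {b : arr X B} {v : arr B A}.

Lemma tens_sol_comp {a' m' : arr _ _} {b' v' : arr _ _}
    (f : arr2 a a') (g : arr2 b b') (h : arr2 m m') (k : arr2 v v')
    (S : arr2 (unit1 B) (a \ox b)) (T : arr2 (unit1 A) (m \ox v)) :
  tens_sol ((f \hx g) \vo S) ((h \hx k) \vo T) =
  ((h \hx f) \hx (g \hx k)) \vo tens_sol S T.
Proof.
apply: heq_eq; apply: heq_trans (heq_tens_sol _ _) _; apply: heq_sym.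
refine (heq_trans (Y :=
  ((h \hx (f \hx (g \hx k))) \vo ((m \wl cup S v) \vo T))) _ _).
  apply: heq_vcomp (heq_tens_sol _ _).
  exact: heq_hcompA.
apply: eq_heq; rewrite cup_comp !vA !hv v1l v1r -vA cup_nat vA hv v1r.
by rewrite wr_wl.
Qed.

Lemma tens_sol_sum (I J : finType) (S : I -> arr2 (unit1 B) (a \ox b))
    (T : J -> arr2 (unit1 A) (m \ox v)) :
  tens_sol (\sum_i S i) (\sum_j T j) =
  \sum_(p : I * J) tens_sol (S p.1) (T p.2).
Proof.
rewrite -(pair_bigA _ (fun i j => tens_sol (S i) (T j))) /tens_sol /=.
rewrite exchange_big v_sumr; apply: eq_bigr => j _.
by rewrite h_suml h_sumr v_sumr !v_suml.
Qed.
End TensSolSum.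

(** The zigzag of [r] is straightened first by naturality, leaving that of [s]. *)
Lemma conj_eq_tens {X B A : C} {r : arr B A} {rb : arr A B}
    {s : arr X B} {sb : arr B X}
    (Rr : arr2 (unit1 A) (rb \ox r)) (Rbr : arr2 (unit1 B) (r \ox rb))
    (Rs : arr2 (unit1 B) (sb \ox s)) (Rbs : arr2 (unit1 X) (s \ox sb)) :
  conj_eq Rr Rbr -> conj_eq Rs Rbs ->
  conj_eq (r := s \ox r) (rb := rb \ox sb) (tens_sol Rs Rr) (tens_sol Rbr Rbs).
Proof.
move=> RS SS; apply/conj_eqP; set t := unit1 A; apply: heq_eq.
apply: (@heq_trans _ _ _ _ _ _ _ _ _ _ _
  (dag ((s \wl cup Rbr (sb \ox (s \ox (r \ox t)))) \vo cup Rbs (s \ox (r \ox t)))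
   \vo (s \wl (r \wl ((rb \wl cup Rs (r \ox t)) \vo cup Rr t))))).
  apply: heq_vcomp.
    apply: heq_dag; apply: heq_trans (heq_cup_tens_sol _ _ _) _.
    by rewrite (tensA s r t); exact: heq_refl.
  rewrite -h11; apply: heq_trans (heq_hcompA _ _ _) _.
  exact: heq_hcomp (heq_refl _) (heq_hcomp (heq_refl _) (heq_cup_tens_sol _ _ _)).
rewrite dagv dag_wl -vA -wl_comp (wl_comp r) vA cup_dag_nat -vA (conj_cup RS).
by rewrite v1r (conj_cup SS); apply: heq_id2; rewrite tensA.
Qed.

Section TensBalanced.
Context {X B A : C} {r : arr B A} {rb : arr A B} {s : arr X B} {sb : arr B X}.
Variables (Rr : arr2 (unit1 A) (rb \ox r)) (Rbr : arr2 (unit1 B) (r \ox rb)).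
Variables (Rs : arr2 (unit1 B) (sb \ox s)) (Rbs : arr2 (unit1 X) (s \ox sb)).
Variable T : arr2 (s \ox r) (s \ox r).

(** [Y] closes the [s] leg of [T] on the left; [Z] below closes its [r] leg on the right. They are
    the two partial traces of [T]. *)
Let Y : arr2 r r := dag (cup Rs r) \vo (sb \wl T) \vo cup Rs r.

Let Tr {D : C} (u : arr A D) : arr2 (s \ox (r \ox u)) (s \ox (r \ox u)) :=
  idto (tensA s r u) \vo (T \wr u) \vo idto (esym (tensA s r u)).

Let Z : arr2 s s :=
  idto (tens1r s) \vo (dag (s \wl Rbr) \vo Tr rb \vo (s \wl Rbr))
    \vo idto (esym (tens1r s)).

Let heq_Tr {D : C} (u : arr A D) : heq (Tr u) (T \wr u).
Proof. by apply: heq_idtor; apply: heq_idtol; exact: heq_refl. Qed.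

Lemma lphi_tens_sol : lphi (tens_sol Rs Rr) T = lphi Rr Y.
Proof.
apply: heq_eq.
apply: (@heq_trans _ _ _ _ _ _ _ _ _ _ _ (dag ((rb \wl cup Rs r) \vo Rr)
  \vo (rb \wl (sb \wl T)) \vo ((rb \wl cup Rs r) \vo Rr))).
  apply: heq_vcomp (heq_tens_sol _ _); apply: heq_vcomp.
    exact: heq_dag (heq_tens_sol _ _).
  by rewrite -h11; exact: heq_hcompA.
by apply: eq_heq; rewrite /lphi /Y dagv dag_wl !wl_comp !vA.
Qed.

(** Both sides close the [s] leg on the left and the [r] leg on the right, in opposite orders. *)
Lemma rphi_lphi_tens : rphi Rbr Y = lphi Rs Z.
Proof.
apply: heq_eq.
apply: (@heq_trans _ _ _ _ _ _ _ _ _ _ _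
  (dag (cup Rs (r \ox rb) \vo Rbr) \vo (sb \wl Tr rb) \vo
    (cup Rs (r \ox rb) \vo Rbr))).
  rewrite /rphi dagv -!vA; apply: heq_vcomp (heq_refl _) _.
  rewrite !vA; apply: heq_vcomp (heq_refl _); rewrite !wr_comp.
  apply: heq_vcomp (heq_cup_tens _ _ _); apply: heq_vcomp.
    by rewrite -dag_wr; apply: heq_dag; exact: heq_cup_tens.
  apply: heq_trans (heq_hcompA _ _ _) _.
  exact: heq_hcomp (heq_refl _) (heq_sym (heq_Tr _)).
rewrite !cup_nat; apply: heq_sym.
rewrite /lphi.
apply: (@heq_trans _ _ _ _ _ _ _ _ _ _ _
  (dag (cup Rs (unit1 B)) \vo (sb \wl (dag (s \wl Rbr) \vo Tr rb \vo (s \wl Rbr)))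
    \vo cup Rs (unit1 B))).
  have RsE : heq Rs (cup Rs (unit1 B)).
    exact: heq_trans (heq_sym (heq_hcomp1r _)) (heq_sym (heq_cup _ _)).
  apply: heq_vcomp (RsE); apply: heq_vcomp (heq_dag RsE) _.
  apply: heq_hcomp (heq_refl _) _.
  by apply: heq_idtor; apply: heq_idtol; exact: heq_refl.
by apply: eq_heq; rewrite dagv !dag_wl !wl_comp !vA.
Qed.

Lemma rphi_tens_sol : rphi (tens_sol Rbr Rbs) T = rphi Rbs Z.
Proof.
apply: heq_eq.
apply: (@heq_trans _ _ _ _ _ _ _ _ _ _ _
  (dag ((s \wl cup Rbr sb) \vo Rbs) \vo Tr (rb \ox sb)
    \vo ((s \wl cup Rbr sb) \vo Rbs))).
  apply: heq_vcomp (heq_tens_sol _ _); apply: heq_vcomp.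
    exact: heq_dag (heq_tens_sol _ _).
  exact/heq_sym/heq_Tr.
apply: (@heq_trans _ _ _ _ _ _ _ _ _ _ _
  (dag Rbs \vo (dag (s \wl cup Rbr sb) \vo Tr (rb \ox sb) \vo (s \wl cup Rbr sb))
    \vo Rbs)); first by apply: eq_heq; rewrite dagv !vA.
apply: heq_vcomp (heq_refl _); apply: heq_vcomp (heq_refl _) _; apply: heq_sym.
apply: heq_trans (heq_hcomp (heq_idtor _ (heq_idtol _ (heq_refl _)))
  (heq_refl _)) _.
have cupE' : heq ((s \wl Rbr) \wr sb) (s \wl cup Rbr sb).
  apply: heq_trans (heq_hcompA _ _ _) _.
  exact: heq_hcomp (heq_refl _) (heq_sym (heq_cup _ _)).
rewrite 2!wr_comp; apply: heq_vcomp (cupE'); apply: heq_vcomp.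
  by rewrite -dag_wr; apply: heq_dag.
apply: heq_trans (heq_hcomp (heq_Tr _) (heq_refl _)) _.
by apply: heq_trans (heq_hcompA _ _ _) _; rewrite h11; exact/heq_sym/heq_Tr.
Qed.

(** Standardness for [r] at [Y] moves the scalar between [s] and [r]; there it is a left inverse at
    [Z], and standardness for [s] moves it to the far left. *)
Lemma ract_lphi_tens_sol :
  (forall F, ract r (lphi Rr F) = lact r (rphi Rbr F)) ->
  (forall F, ract s (lphi Rs F) = lact s (rphi Rbs F)) ->
  ract (s \ox r) (lphi (tens_sol Rs Rr) T) =
  lact (s \ox r) (rphi (tens_sol Rbr Rbs) T).
Proof.
move=> stdr stds; rewrite lphi_tens_sol rphi_tens_sol.
by rewrite ract_tens stdr -ract_lact rphi_lphi_tens stds -lact_tens.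
Qed.
End TensBalanced.

Lemma standard_balanced_tens {X B A : C} {r : arr B A} {rb : arr A B}
    {s : arr X B} {sb : arr B X}
    (Rr : arr2 (unit1 A) (rb \ox r)) (Rbr : arr2 (unit1 B) (r \ox rb))
    (Rs : arr2 (unit1 B) (sb \ox s)) (Rbs : arr2 (unit1 X) (s \ox sb)) :
  is_standard_balanced Rr Rbr -> is_standard_balanced Rs Rbs ->
  is_standard_balanced (r := s \ox r) (rb := rb \ox sb)
    (tens_sol Rs Rr) (tens_sol Rbr Rbs).
Proof.
move=> [[RS RS'] stdr] [[SS SS'] stds]; split.
  by split; apply: conj_eq_tens.
by move=> T; exact: ract_lphi_tens_sol.
Qed.

Lemma fdsum_tens {X B A : C} (I J : finType) {s_ : I -> arr X B} {s : arr X B}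
    {r_ : J -> arr B A} {r : arr B A}
    (V : forall i, arr2 (s_ i) s) (W : forall j, arr2 (r_ j) r) :
  is_fdsum V -> is_fdsum W -> is_fdsum (fun p : I * J => V p.1 \hx W p.2).
Proof.
move=> [Vi Vo V1] [Wi Wo W1]; split=> [[i j]|[i j] [i' j'] /=|].
- by rewrite /is_isometry dagh hv (Vi i) (Wi j) h11.
- rewrite xpair_eqE negb_and dagh hv => /orP[/Vo|/Wo] ->; first exact: h0l.
  exact: h0r.
rewrite -(pair_bigA _ (fun i j => (V i \hx W j) \vo dag (V i \hx W j))) /=.
rewrite -h11 -V1 h_suml; apply: eq_bigr => i _.
by rewrite -W1 h_sumr; apply: eq_bigr => j _; rewrite dagh hv.
Qed.

Lemma fdsum_reindex {B A : C} (I J : finType) {r_ : I -> arr B A} {r : arr B A}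
    (W : forall i, arr2 (r_ i) r) (h : J -> I) :
  bijective h -> is_fdsum W -> is_fdsum (fun j => W (h j)).
Proof.
move=> hbij [Wi Wo W1]; split=> [j|j j' jj'|]; first exact: Wi.
  by apply: Wo; rewrite (inj_eq (bij_inj hbij)).
by rewrite -W1 [RHS](reindex h) //; exact: onW_bij.
Qed.

Lemma standard_tens {X B A : C} (r : arr B A) (rb : arr A B)
    (s : arr X B) (sb : arr B X)
    (Rr : arr2 (unit1 A) (rb \ox r)) (Rbr : arr2 (unit1 B) (r \ox rb))
    (Rs : arr2 (unit1 B) (sb \ox s)) (Rbs : arr2 (unit1 X) (s \ox sb)) :
  is_standard Rr Rbr -> is_standard Rs Rbs ->
  is_standard (r := s \ox r) (rb := rb \ox sb)
    (tens_sol Rs Rr) (tens_sol Rbr Rbs).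
Proof.
case/standard_decomposition => -[J r_ rb_ W Wb R_ Rb_ Ws Wbs rbal stdr -> ->] _.
case/standard_decomposition => -[I s_ sb_ V Vb S_ Sb_ Vs Vbs sbal stds -> ->] _.
(* Conjugation reverses tensor products, so sums over [rb \ox sb] run over the pairs in the other
   order. *)
have swap_bij : bijective (fun p : I * J => (p.2, p.1)).
  by exists (fun p => (p.2, p.1)) => -[].
apply: decomposition_standard.
apply: (Decomposition (dI := (I * J)%type)
  (dr := fun p => s_ p.1 \ox r_ p.2) (drb := fun p => rb_ p.2 \ox sb_ p.1)
  (dW := fun p => V p.1 \hx W p.2) (dWb := fun p => Wb p.2 \hx Vb p.1)
  (dR := fun p => tens_sol (S_ p.1) (R_ p.2))
  (dRb := fun p => tens_sol (Rb_ p.2) (Sb_ p.1))).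
- exact: fdsum_tens.
- exact: fdsum_reindex swap_bij (fdsum_tens Wbs Vbs).
- move=> [i j]; have [rj rbj] := rbal j; have [si sbi] := sbal i.
  by split; apply: balanced_tens.
- by move=> [i j]; apply: standard_balanced_tens.
- rewrite tens_sol_sum; apply: eq_bigr => -[i j] _; exact: tens_sol_comp.
rewrite tens_sol_sum [LHS](reindex _ (onW_bij _ swap_bij)).
by apply: eq_bigr => -[i j] _; exact: tens_sol_comp.
Qed.

End TensorProducts.

Close Scope ring_scope.
Close Scope classical_set_scope.

Theorem proposition3p14 (R : realType) (C : twoCstarCat R)
    (hproj : closed_under_projections C)
    (hdsum : closed_under_dsums C)
    (hconj : closed_under_conjugation C)
    (hbal : all_dsum_of_centrally_balanced C) :
  (* direct sums *)
  (forall (B A : C) (r_ : 'I_2 -> arr B A) (rb_ : 'I_2 -> arr A B)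
     (r : arr B A) (rb : arr A B)
     (W : forall i, arr2 (r_ i) r) (Wb : forall i, arr2 (rb_ i) rb)
     (R_ : forall i, arr2 (unit1 A) (rb_ i \ox r_ i))
     (Rb_ : forall i, arr2 (unit1 B) (r_ i \ox rb_ i)),
     (forall i, is_standard (R_ i) (Rb_ i)) ->
     is_dsum W -> is_dsum Wb ->
     is_standard (dsum_sol W Wb R_) (dsum_sol Wb W Rb_)) /\
  (* tensor products *)
  (forall (X B A : C) (r : arr B A) (rb : arr A B) (s : arr X B) (sb : arr B X)
     (Rr : arr2 (unit1 A) (rb \ox r)) (Rbr : arr2 (unit1 B) (r \ox rb))
     (Rs : arr2 (unit1 B) (sb \ox s)) (Rbs : arr2 (unit1 X) (s \ox sb)),
     is_standard Rr Rbr -> is_standard Rs Rbs ->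
     is_standard (r := s \ox r) (rb := rb \ox sb)
       (tens_sol Rs Rr) (tens_sol Rbr Rbs)) /\
  (* projections *)
  (forall (B A : C) (r : arr B A) (rb : arr A B)
     (Rr : arr2 (unit1 A) (rb \ox r)) (Rb : arr2 (unit1 B) (r \ox rb))
     (rP : arr B A) (W : arr2 rP r) (P : arr2 r r),
     is_standard Rr Rb -> is_isometry W -> is_projection P -> W \vo dag W = P ->
     exists (rbP : arr A B) (Wb : arr2 rbP rb),
       is_isometry Wb /\
       is_standard (r := rP) (rb := rbP)
         ((dag Wb \hx dag W) \vo Rr) ((dag W \hx dag Wb) \vo Rb)) /\
  (* conjugation *)
  (forall (B A : C) (r : arr B A) (rb : arr A B)
     (Rr : arr2 (unit1 A) (rb \ox r)) (Rb : arr2 (unit1 B) (r \ox rb)),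
     is_standard Rr Rb -> is_standard Rb Rr).
Proof.
split; first by move=> B A r_ rb_ r rb W Wb R_ Rb_; exact: standard_dsum.
split; first by move=> X B A r rb s sb Rr Rbr Rs Rbs; exact: standard_tens.
split; last by move=> B A r rb Rr Rb; exact: standard_conj.
move=> B A r rb Rr Rb rP W P std Wi _ _.
exact: (standard_proj hproj hdsum hbal std Wi).
Qed.
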